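(* Consider the game $G^{\ast}$ described in the context, with countably many pursuers $p_j$, $j\in J=\{1,2,\dots\}$, initial positions $p_{j0}\in l_2$, speed bounds $\alpha_j>0$, one evader $e$ with initial data $e^0,e^1\in l_2$ and acceleration bound $\beta>0$, and duration $\theta>0$. Put $e_0=e^0+\theta e^1$. Suppose there is $\gamma\in l_2$, $\gamma\neq 0$, such that $\langle e_0-p_{j0},\gamma\rangle\ge 0$ for all $j\in J$. Then the number $$\varphi=\inf\left\{\epsilon\ge 0:\ H\!\left(e_0,\beta\tfrac{\theta^2}{2}\right)\subset\bigcup_{j\in J}H\!\left(p_{j0},\alpha_j\theta+\epsilon\right)\right\}$$ is the value of the game $G^{\ast}$.
   Context: $l_2$ is the real Hilbert space of square-summable sequences, with its standard inner product $\langle\cdot,\cdot\rangle$ and norm $\|\cdot\|$. $H(\upsilon,r)=\{p\in l_2:\|p-\upsilon\|\le r\}$ is the closed ball of center $\upsilon$ and radius $r$. Game $G^{\ast}$. The time interval is $[0,\theta]$, $\theta>0$ fixed. The motions take place in $l_2$ and are given by $$\dot p_j=a_j(t),\quad p_j(0)=p_{j0}\quad (j\in J=\{1,2,\dots\}),\qquad \ddot e=b(t),\quad \dot e(0)=e^1,\ e(0)=e^0 .$$ Hence $p_j(\theta)=p_{j0}+\int_0^\theta a_j(t)\,dt$ and $e(\theta)=e_0+\int_0^\theta(\theta-t)b(t)\,dt$ with $e_0=e^0+\theta e^1$. (Equivalently, as far as positions at time $\theta$ are concerned, the evader's equation may be replaced by $\dot e=(\theta-t)b(t)$, $e(0)=e_0$.)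 Admissible controls. An admissible control of pursuer $p_j$ is a function $a_j:[0,\theta]\to l_2$ with measurable coordinates and $\|a_j(t)\|\le\alpha_j$ for $0\le t\le\theta$. An admissible control of the evader is a function $b:[0,\theta]\to l_2$ with measurable coordinates and $\|b(t)\|\le\beta$ for $0\le t\le\theta$. Pursuers' strategies. A strategy $A_j$ of pursuer $p_j$ assigns to the initial positions $p_{j0},e_0$ and to each admissible evader control $b(\cdot)$ (known to the pursuer in its entirety at time $0$) a measurable function $t\mapsto A_j(t,p_{j0},e_0,b(\cdot))\in l_2$ with $\|A_j(t,p_{j0},e_0,b(\cdot))\|\le\alpha_j$ on $[0,\theta]$, such that the system with $a_j(t)=A_j(t,p_{j0},e_0,b(\cdot))$ has a unique solution $(p_j(\cdot),e(\cdot))$ for every admissible $b(\cdot)$. Put $$\Psi_1(A_1,A_2,\dots)=\sup_{b(\cdot)}\inf_{j\in J}\|p_j(\theta)-e(\theta)\|,$$ where the supremum is over admissible controls of the evader and $p_j$ is generated by $A_j$. Pursuers' strategies $\bar A_1,\bar A_2,\dots$ are optimal if $\Psi_1(\bar A_1,\bar A_2,\dots)=\inf_{A_1,A_2,\dots}\Psi_1(A_1,A_2,\dots)$. Evader's strategies. A strategy of the evader is a measurable $l_2$-valued function $B(t,p_1,p_2,\dots,e)$ of $t\in[0,\theta]$ and of $p_1,p_2,\dots,e\in l_2$ with $\|B\|\le\beta$, such that the system with $b(t)=B(t,p_1(t),p_2(t),\dots,e(t))$ has a unique solution for all admissible controls $a_1(\cdot),a_2(\cdot),\dots$ of the pursuers.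 Put $$\Psi_2(B)=\inf_{a_1(\cdot),a_2(\cdot),\dots}\ \inf_{j\in J}\|p_j(\theta)-e(\theta)\|,$$ where the first infimum is over admissible controls of the pursuers and $e$ is generated by $B$. A strategy $\bar B$ is optimal if $\Psi_2(\bar B)=\sup_B\Psi_2(B)$. Value. The number $\varphi$ is the value of the game if there are optimal strategies $\bar A_1,\bar A_2,\dots$ of the pursuers and $\bar B$ of the evader with $\Psi_1(\bar A_1,\bar A_2,\dots)=\varphi=\Psi_2(\bar B)$.
   Formalization: ''The system has a unique solution'' is read as uniqueness on every initial segment [0,τ], τ≤θ, not only on [0,θ]; otherwise an evader strategy whose branches die out depending on the pursuers' later motion could foresee it and exceed φ. *)

(* Defs.v *)
From HB Require Import structures.
From mathcomp Require Import all_boot all_order all_algebra.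
From mathcomp Require Import all_classical all_reals all_analysis.
From mathcomp Require Import ring.

Set Implicit Arguments.
Unset Strict Implicit.
Unset Printing Implicit Defensive.

Import Order.TTheory GRing.Theory Num.Theory.
Import numFieldNormedType.Exports.

Local Open Scope classical_set_scope.
Local Open Scope ring_scope.

(* Sequences take values in R^o, rather than R, only in order to inherit the
   pointwise lmodType structure on functions. *)
Definition square_summable (R : realType) : {pred (nat -> R^o)} :=
  [pred x | `[< cvgn (series (fun i => (x i : R) ^+ 2)) >]].

Fact square_summable_comb (R : realType) (a : R) (x y : R^nat) :
  cvgn (series (fun i => x i ^+ 2)) -> cvgn (series (fun i => y i ^+ 2)) ->
  cvgn (series (fun i => (a * x i + y i) ^+ 2)).
Proof.
move=> cx cy.
pose v : R^nat := fun i => (2 * a ^+ 2) * x i ^+ 2 + 2 * y i ^+ 2.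
have cv : cvgn (series v).
  have -> : series v = (fun n => (2 * a ^+ 2) * series (fun i => x i ^+ 2) n) \+
      (fun n => 2 * series (fun i => y i ^+ 2) n).
    apply/funext => n.
    by rewrite /series /v /= big_split/= !mulr_sumr.
  by apply: is_cvgD; apply: is_cvgM => //; exact: is_cvg_cst.
apply: series_le_cvg cv => [i|i|i].
- exact: sqr_ge0.
- by rewrite /v addr_ge0// mulr_ge0 ?sqr_ge0// mulr_ge0 ?sqr_ge0.
- rewrite /v -subr_ge0.
  have -> : 2 * a ^+ 2 * x i ^+ 2 + 2 * y i ^+ 2 - (a * x i + y i) ^+ 2 =
      (a * x i - y i) ^+ 2 by ring.
  exact: sqr_ge0.
Qed.

Fact square_summable_submod (R : realType) :
  submod_closed (@square_summable R).
Proof.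
split=> [|a x y]; rewrite !inE; last exact: square_summable_comb.
have -> : series (fun i => ((0 : nat -> R^o) i : R) ^+ 2) = cst 0.
  by apply/funext => n; rewrite /series /= big1// => i _; rewrite expr2 mulr0.
exact: is_cvg_cst.
Qed.

HB.instance Definition _ (R : realType) :=
  GRing.isSubmodClosed.Build R (nat -> R^o) (@square_summable R)
    (square_summable_submod R).

Record l2 (R : realType) := L2 {
  coord :> nat -> R^o ;
  _ : coord \in @square_summable R }.

HB.instance Definition _ (R : realType) := [isSub for @coord R].
HB.instance Definition _ (R : realType) := [Choice of l2 R by <:].
HB.instance Definition _ (R : realType) := [SubChoice_isSubLmodule of l2 R by <:].
HB.instance Definition _ (R : realType) := isPointed.Build (l2 R) 0.

Definition l2dot (R : realType) (x y : l2 R) : R :=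
  limn (series (fun i => (x i : R) * y i)).

Definition l2norm (R : realType) (x : l2 R) : R := Num.sqrt (l2dot x x).

Definition l2ball (R : realType) (c : l2 R) (r : R) : set (l2 R) :=
  [set p | l2norm (p - c) <= r].

Definition l2open (R : realType) (U : set (l2 R)) : Prop :=
  forall x, U x -> exists2 r : R, 0 < r & forall y, l2norm (y - x) < r -> U y.

Definition l2borel (R : realType) : Type := g_sigma_algebraType (@l2open R).

Definition cylinder (R : realType) (C : set (nat -> l2 R)) : Prop :=
  exists j, exists2 U : set (l2borel R), measurable U & C = [set p | U (p j)].

Definition l2seqborel (R : realType) : Type := g_sigma_algebraType (@cylinder R).

(* Pursuers are numbered from 0. [evader_pos] and [evader_vel] are the initial
   position e^0 and the initial velocity e^1. *)
Record game (R : realType) := Game {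
  duration : R ;
  speed : nat -> R ;
  accel : R ;
  pursuer_pos : nat -> l2 R ;
  evader_pos : l2 R ;
  evader_vel : l2 R }.

(* The point e_0 = e^0 + theta e^1. *)
Definition evader_drift (R : realType) (theta : R) (e0 e1 : l2 R) : l2 R :=
  e0 + theta *: e1.

(* A control on [0, theta] is a total function of which only the values on
   [0, theta] are ever used. *)
Definition admissible (R : realType) (theta rho : R) (a : R -> l2 R) : Prop :=
  (forall i, measurable_fun `[0, theta] (fun t => a t i : R)) /\
  (forall t, 0 <= t <= theta -> l2norm (a t) <= rho).

(* x is a Caratheodory solution of x' = f(t), x(0) = x0 on [0, tau]. *)
Definition integral_curve (R : realType) (tau : R) (x0 : l2 R)
    (f x : R -> l2 R) : Prop :=
  forall i,
    lebesgue_measure.-integrable `[0, tau] (fun s => (f s i : R)%:E) /\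
    forall t, 0 <= t <= tau ->
      x t i = x0 i + \int[lebesgue_measure]_(s in `[0, t]) (f s i : R).

(* e is a Caratheodory solution of e'' = b(t), e(0) = e0, e'(0) = e1
   on [0, tau]. *)
Definition second_order_curve (R : realType) (tau : R) (e0 e1 : l2 R)
    (b e : R -> l2 R) : Prop :=
  exists2 v : R -> l2 R,
    integral_curve tau e1 b v & integral_curve tau e0 v e.

(* [solves tau x] reads: x solves the Cauchy problem on [0, tau].  As usual for
   Cauchy problems, uniqueness concerns the solutions on every initial segment
   [0, tau] of [0, theta], not only those that reach theta. *)
Definition unique_solution (R : realType) (T : Type) (theta : R)
    (solves : R -> (R -> T) -> Prop) : Prop :=
  (exists x, solves theta x) /\
  forall tau x y, 0 <= tau <= theta -> solves tau x -> solves tau y ->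
    forall t, 0 <= t <= tau -> x t = y t.

Definition pursuer_strategy_type (R : realType) : Type :=
  l2 R -> l2 R -> (R -> l2 R) -> R -> l2 R.

(* The arguments of a strategy are p_{j0}, e_0 and the evader's control.  The
   second clause makes up for controls being total functions. *)
Definition pursuer_strategy (R : realType) (theta alpha beta : R)
    (A : pursuer_strategy_type R) : Prop :=
  [/\ forall p0 d b, admissible theta beta b ->
        admissible theta alpha (A p0 d b),
      forall p0 d b b',
        admissible theta beta b -> admissible theta beta b' ->
        (forall t, 0 <= t <= theta -> b t = b' t) ->
        forall t, 0 <= t <= theta -> A p0 d b t = A p0 d b' t &
      forall p0 e0 e1 b, admissible theta beta b ->
        unique_solution theta (fun tau (z : R -> l2 R * l2 R) =>
          integral_curve tau p0 (A p0 (evader_drift theta e0 e1) b)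
            (fun t => (z t).1) /\
          second_order_curve tau e0 e1 b (fun t => (z t).2))].

Definition evader_strategy_type (R : realType) : Type :=
  R -> (nat -> l2 R) -> l2 R -> l2 R.

Definition closed_loop (R : realType) (G : game R) (a : nat -> R -> l2 R)
    (B : evader_strategy_type R) (tau : R)
    (z : R -> (nat -> l2 R) * l2 R) : Prop :=
  (forall j, integral_curve tau (pursuer_pos G j) (a j) (fun t => (z t).1 j)) /\
  second_order_curve tau (evader_pos G) (evader_vel G)
    (fun t => B t (z t).1 (z t).2) (fun t => (z t).2).

Definition evader_strategy (R : realType) (G : game R)
    (B : evader_strategy_type R) : Prop :=
  [/\ measurable_fun
        (`[0, duration G] `*` setT `*` setT :
           set (measurableTypeR R * l2seqborel R * l2borel R))
        (fun z => B z.1.1 z.1.2 z.2 : l2borel R),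
      forall t p e, 0 <= t <= duration G -> l2norm (B t p e) <= accel G &
      forall a, (forall j, admissible (duration G) (speed G j) (a j)) ->
        unique_solution (duration G) (closed_loop G a B)].

Definition miss_distance (R : realType) (p : nat -> l2 R) (e : l2 R) : \bar R :=
  ereal_inf (range (fun j => (l2norm (p j - e))%:E)).

Definition pursuers_play (R : realType) (G : game R)
    (A : nat -> pursuer_strategy_type R) (b : R -> l2 R)
    (p : nat -> R -> l2 R) (e : R -> l2 R) : Prop :=
  (forall j, integral_curve (duration G) (pursuer_pos G j)
     (A j (pursuer_pos G j)
        (evader_drift (duration G) (evader_pos G) (evader_vel G)) b) (p j)) /\
  second_order_curve (duration G) (evader_pos G) (evader_vel G) b e.

Definition Psi1 (R : realType) (G : game R)
    (A : nat -> pursuer_strategy_type R) : \bar R :=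
  ereal_sup [set m | exists b p e,
    [/\ admissible (duration G) (accel G) b, pursuers_play G A b p e &
        m = miss_distance (p^~ (duration G)) (e (duration G))]].

Definition Psi2 (R : realType) (G : game R)
    (B : evader_strategy_type R) : \bar R :=
  ereal_inf [set m | exists a z,
    [/\ forall j, admissible (duration G) (speed G j) (a j),
        closed_loop G a B (duration G) z &
        m = miss_distance (z (duration G)).1 (z (duration G)).2]].

Definition pursuer_strategies (R : realType) (G : game R)
    (A : nat -> pursuer_strategy_type R) : Prop :=
  forall j, pursuer_strategy (duration G) (speed G j) (accel G) (A j).

Definition optimal_pursuer_strategies (R : realType) (G : game R)
    (A : nat -> pursuer_strategy_type R) : Prop :=
  pursuer_strategies G A /\
  Psi1 G A = ereal_inf [set Psi1 G A' | A' in pursuer_strategies G].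

Definition optimal_evader_strategy (R : realType) (G : game R)
    (B : evader_strategy_type R) : Prop :=
  evader_strategy G B /\
  Psi2 G B = ereal_sup [set Psi2 G B' | B' in evader_strategy G].

Definition is_value (R : realType) (G : game R) (phi : R) : Prop :=
  exists A B,
    [/\ optimal_pursuer_strategies G A, optimal_evader_strategy G B,
        Psi1 G A = phi%:E & Psi2 G B = phi%:E].

(* Main.v *)
Require Import Defs.
From HB Require Import structures.
From mathcomp Require Import all_boot all_order all_algebra.
From mathcomp Require Import all_classical all_reals all_analysis.
From mathcomp Require Import measurable_realfun ring lra.

(* Let [rho = beta theta^2 / 2] and let [R_j = alpha_j theta + eps], so that the balls
   [H(p_j0, R_j)] cover [H(e_0, rho)] for [eps > phi] and do not for [eps < phi].  Pushing
   a point of [H(e_0, rho)] along [gamma] to the sphere shows that a covering of the ball by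
   balls is also a covering by the half-spaces
   [X_j = {m : |m - p_j0|^2 - R_j^2 <= |m - e_0|^2 - rho^2}].  Conversely, weak compactness
   yields a point [x] of the ball with [|x - p_j0| >= alpha_j theta + phi] for all [j].

   The evader secures [phi] by heading for [x] with constant acceleration; pursuers who know
   [b(.)] secure [phi] by heading straight for [e(theta)].  The remaining inequality
   [Psi_2(B) <= phi] is not formal, because a closed-loop [B] reacts to the pursuers.  They
   play step by step: at the beginning of each step only the past trajectory, which by
   uniqueness does not depend on the future controls, is used.  The predicted final position
   [y(t) = e(t) + (theta - t) e'(t)] moves inside shrinking balls of radius
   [beta (theta - t)^2 / 2] and is followed with a small delay by a point [Y].  A fictitious
   pursuer of reach [R_j] maintains the property that it can still guard all of [X_j]
   against [Y] (lemma [guard_step]; this uses that the evader's reach decreases like the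
   square of the remaining time), hence it catches [Y] if [Y] ends in [X_j].  The actual
   pursuer performs the same motion scaled by [alpha_j theta / R_j] and ends at distance at
   most [eps] from the fictitious one. *)

Set Implicit Arguments.
Unset Strict Implicit.
Unset Printing Implicit Defensive.

Import Order.TTheory GRing.Theory Num.Theory.
Import numFieldNormedType.Exports.

Local Open Scope classical_set_scope.
Local Open Scope ring_scope.

(** * Hilbert spaces and the space l2 *)

(** Completeness is stated with a modulus [eta] that the limit inherits, so that [V] can remain a
    bare module without topology. *)
Record hilbert {R : realType} {V : lmodType R} (dot : V -> V -> R) : Prop := Hilbert {
  dotC : forall x y, dot x y = dot y x ;
  dotDl : forall x y z, dot (x + y) z = dot x z + dot y z ;
  dotZl : forall a x z, dot (a *: x) z = a * dot x z ;
  dot_ge0 : forall x, 0 <= dot x x ;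
  dot_eq0 : forall x, dot x x = 0 -> x = 0 ;
  dot_complete : forall (x : nat -> V) (eta : R^nat), eta @ \oo --> (0 : R) ->
    (forall n m, (n <= m)%N -> dot (x m - x n) (x m - x n) <= eta n) ->
    exists l, forall n, dot (l - x n) (l - x n) <= eta n }.

Section SequenceSpace.
Context {R : realType}.
Implicit Types (x y z u : l2 R) (a b c : R).

Lemma l2P x y : (forall i, x i = y i) -> x = y.
Proof. by move=> h; apply: val_inj; apply/funext. Qed.

Lemma coordD x y i : (x + y) i = x i + y i. Proof. by []. Qed.
Lemma coordN x i : (- x) i = - x i. Proof. by []. Qed.
Lemma coordZ a x i : (a *: x) i = a * x i. Proof. by []. Qed.

Lemma is_cvg_sqr_coord x : cvgn (series (fun i => (x i : R) ^+ 2)).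
Proof. by case: x => f /=; rewrite inE. Qed.

(** Polarization writes the product through the squares of [x + y], [x] and [y], whose series
    converge. *)
Lemma is_cvg_dot x y : cvgn (series (fun i => (x i : R) * y i)).
Proof.
pose sq z : R^nat := fun i => (z i : R) ^+ 2.
have csq z : cvgn (series (sq z)) by exact: is_cvg_sqr_coord.
have -> : (fun i => (x i : R) * y i) =
    2^-1 *: (sq (x + y) + (-1) *: (sq x + sq y)).
  apply/funext => i; rewrite -[RHS]/(2^-1 * ((x i + y i) ^+ 2 + -1 * (x i ^+ 2 + y i ^+ 2))).
  by field.
apply: is_cvg_seriesZ; apply: is_cvg_seriesD => //.
by apply: is_cvg_seriesZ; exact: is_cvg_seriesD.
Qed.

Lemma l2dotC x y : l2dot x y = l2dot y x.
Proof.
by rewrite /l2dot; congr (limn (series _)); apply/funext => i; rewrite mulrC.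
Qed.

Lemma l2dotDl x y z : l2dot (x + y) z = l2dot x z + l2dot y z.
Proof.
rewrite /l2dot -(lim_seriesD (@is_cvg_dot x z) (@is_cvg_dot y z)).
by congr (limn (series _)); apply/funext => i; rewrite -mulrDl.
Qed.

Lemma l2dotZl a x z : l2dot (a *: x) z = a * l2dot x z.
Proof.
rewrite /l2dot; apply: etrans (lim_seriesZ a (@is_cvg_dot x z)).
by congr (limn (series _)); apply/funext => i; rewrite [RHS]mulrA.
Qed.

Lemma sum_sqr_le_l2dot x n : \sum_(i < n) (x i : R) ^+ 2 <= l2dot x x.
Proof.
have cx : cvgn (series (fun i => (x i : R) ^+ 2)) by exact: is_cvg_sqr_coord.
have -> : l2dot x x = limn (series (fun i => (x i : R) ^+ 2)) by [].
rewrite -(big_mkord xpredT (fun i => (x i : R) ^+ 2)).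
apply: (nondecreasing_cvgn_le _ cx n).
by apply: nondecreasing_series => i _ _; exact: sqr_ge0.
Qed.

Lemma l2dot_le x M : (forall n, \sum_(i < n) (x i : R) ^+ 2 <= M) -> l2dot x x <= M.
Proof.
move=> h; apply: limr_le; first exact: is_cvg_dot.
by apply: nearW => n; rewrite /series/= big_mkord; exact: h.
Qed.

Lemma l2dot_ge0 x : 0 <= l2dot x x.
Proof. by have := sum_sqr_le_l2dot x 0; rewrite big_ord0. Qed.

Lemma exists_l2 (f : nat -> R) M : (forall n, \sum_(i < n) f i ^+ 2 <= M) ->
  exists x, forall i, x i = f i.
Proof.
move=> h; suff cf : (f : nat -> R^o) \in @square_summable R by exists (L2 cf).
rewrite inE; apply: nondecreasing_is_cvgn.
  by apply: nondecreasing_series => i _ _; exact: sqr_ge0.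
by exists M => _ [n _ <-]; rewrite /series/= big_mkord.
Qed.

Lemma coord_sqr_le x i : (x i : R) ^+ 2 <= l2dot x x.
Proof.
apply: le_trans (sum_sqr_le_l2dot x i.+1).
by rewrite big_ord_recr/= lerDr sumr_ge0// => j _; exact: sqr_ge0.
Qed.

Lemma l2dot_eq0 x : l2dot x x = 0 -> x = 0.
Proof.
move=> x0; apply: l2P => i; apply/eqP.
by rewrite -(sqrf_eq0 (x i : R)) eq_le sqr_ge0 -x0 coord_sqr_le.
Qed.

Lemma l2_complete (x : nat -> l2 R) (eta : R^nat) : eta @ \oo --> (0 : R) ->
  (forall n m, (n <= m)%N -> l2dot (x m - x n) (x m - x n) <= eta n) ->
  exists l, forall n, l2dot (l - x n) (l - x n) <= eta n.
Proof.
move=> eta0 xeta.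
have xi i n m : (n <= m)%N -> ((x m i : R) - x n i) ^+ 2 <= eta n.
  move=> nm; apply: le_trans (xeta _ _ nm).
  exact: (coord_sqr_le (x m - x n)).
have cx i : cvgn ((fun n => x n i) : R^nat).
  apply/cauchy_cvgP/cauchy_exP => e e0.
  have : \forall n \near \oo, eta n < e ^+ 2.
    by apply: (cvgr_lt 0) => //; exact: exprn_gt0.
  move=> [n _ /(_ _ (leqnn n))/= ne]; exists (x n i); exists n => // m /= nm.
  rewrite /ball/= distrC -(@ltr_pXn2r _ 2) ?nnegrE ?(ltW e0)//.
  by rewrite real_normK ?num_real//; exact: le_lt_trans (xi _ _ _ nm) ne.
pose l i : R := limn ((fun n => x n i) : R^nat).
have sum_le n k : \sum_(i < k) (l i - (x n i : R)) ^+ 2 <= eta n.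
  have h : (fun m => \sum_(i < k) ((x m i : R) - x n i) ^+ 2) @ \oo -->
      \sum_(i < k) (l i - (x n i : R)) ^+ 2.
    elim: k => [|k IH].
      by under eq_cvg do rewrite big_ord0; rewrite big_ord0; exact: cvg_cst.
    under eq_cvg do rewrite big_ord_recr/=.
    rewrite big_ord_recr/=; apply: cvgD => //; apply: cvgM; apply: cvgB;
      by [exact: cx|exact: cvg_cst].
  apply: (cvgr_to_le h); exists n => // m /= nm.
  exact: le_trans (sum_sqr_le_l2dot (x m - x n) k) (xeta _ _ nm).
(* The bound for [n = 0] places the coordinatewise limit minus [x 0] in l2; adding [x 0] back gives
   the limit itself. *)
have [d dE] := @exists_l2 (fun i => l i - (x 0%N i : R)) _ (sum_le 0%N).
exists (d + x 0%N) => n; apply: l2dot_le => k.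
under eq_bigr do rewrite !coordD coordN dE subrK.
exact: sum_le.
Qed.

Lemma l2_hilbert : hilbert (@l2dot R).
Proof.
split; [exact: l2dotC|exact: l2dotDl|exact: l2dotZl|exact: l2dot_ge0|
  exact: l2dot_eq0|exact: l2_complete].
Qed.

End SequenceSpace.

Section Hilbert.
Context {R : realType} {V : lmodType R} (dot : V -> V -> R).
Hypothesis hdot : hilbert dot.
Implicit Types (x y z u : V) (a b c : R).

Lemma dotNl x z : dot (- x) z = - dot x z.
Proof. by rewrite -scaleN1r (dotZl hdot) mulN1r. Qed.

Lemma dotDr x y z : dot z (x + y) = dot z x + dot z y.
Proof. by rewrite !(dotC hdot z) (dotDl hdot). Qed.

Lemma dotZr a x z : dot z (a *: x) = a * dot z x.
Proof. by rewrite !(dotC hdot z) (dotZl hdot). Qed.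

Lemma dotNr x z : dot z (- x) = - dot z x.
Proof. by rewrite !(dotC hdot z) dotNl. Qed.

Definition dotE := (dotDl hdot, dotDr, dotNl, dotNr, dotZl hdot, dotZr).

(** Reduces an identity between vectors of the abstract [V] to a scalar one that [ring] settles
    after expansion by [dotE]. *)
Lemma dot_ext x y : dot (x - y) (x - y) = 0 -> x = y.
Proof. by move=> /(dot_eq0 hdot)/eqP; rewrite subr_eq0 => /eqP. Qed.

(* At [dot := l2dot], [hnorm] is convertible to [l2norm], and [hball] below to [l2ball]. *)
Definition hnorm x : R := Num.sqrt (dot x x).

Lemma hnorm_ge0 x : 0 <= hnorm x. Proof. exact: sqrtr_ge0. Qed.

Lemma hnorm_sqr x : hnorm x ^+ 2 = dot x x.
Proof. by rewrite sqr_sqrtr// (dot_ge0 hdot). Qed.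

Lemma hnorm0 : hnorm (0 : V) = 0.
Proof. by rewrite /hnorm -(scale0r (0 : V)) (dotZl hdot) mul0r sqrtr0. Qed.

Lemma hnormZ a x : hnorm (a *: x) = `|a| * hnorm x.
Proof.
by rewrite /hnorm (dotZl hdot) dotZr mulrA -expr2 sqrtrM ?sqr_ge0// sqrtr_sqr.
Qed.

Lemma hnormN x : hnorm (- x) = hnorm x.
Proof. by rewrite -scaleN1r hnormZ normrN1 mul1r. Qed.

Lemma hdistC x y : hnorm (x - y) = hnorm (y - x).
Proof. by rewrite -hnormN opprB. Qed.

Lemma hnorm0_eq0 x : hnorm x <= 0 -> x = 0.
Proof.
move=> x0; apply: (dot_eq0 hdot); rewrite -hnorm_sqr; apply/eqP.
by rewrite sqrf_eq0 eq_le x0 hnorm_ge0.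
Qed.

Lemma dot_le_hnorm x y : dot x y <= hnorm x * hnorm y.
Proof.
have [x0|xN0] := eqVneq (hnorm x) 0.
  by rewrite (@hnorm0_eq0 x) ?x0// hnorm0 mul0r -(scale0r (0 : V)) (dotZl hdot) mul0r.
have [y0|yN0] := eqVneq (hnorm y) 0.
  by rewrite (@hnorm0_eq0 y) ?y0// hnorm0 mulr0 -(scale0r (0 : V)) dotZr mul0r.
have xp : 0 < hnorm x by rewrite lt_neqAle eq_sym xN0 hnorm_ge0.
have yp : 0 < hnorm y by rewrite lt_neqAle eq_sym yN0 hnorm_ge0.
(* This squared norm equals [2 p q (p q - d)] in the notation introduced below. *)
have := (dot_ge0 hdot) (hnorm y *: x - hnorm x *: y).
rewrite !dotE -!hnorm_sqr (dotC hdot y x).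
set p := hnorm x in xp *; set q := hnorm y in yp *; set d := dot x y.
move=> h; rewrite -subr_ge0 -(pmulr_rge0 _ (mulr_gt0 xp yp)).
by nra.
Qed.

Lemma ler_hnormD x y : hnorm (x + y) <= hnorm x + hnorm y.
Proof.
rewrite -(@ler_pXn2r _ 2)// ?nnegrE ?addr_ge0 ?hnorm_ge0//.
rewrite hnorm_sqr !dotE -!hnorm_sqr (dotC hdot y x).
by have := dot_le_hnorm x y; nra.
Qed.

Lemma ler_hdistD z x y : hnorm (x - y) <= hnorm (x - z) + hnorm (z - y).
Proof. by rewrite -{1}(subrK z x) -addrA; exact: ler_hnormD. Qed.

Lemma ler_hnorm x a : 0 <= a -> dot x x <= a ^+ 2 -> hnorm x <= a.
Proof.
by move=> a0; rewrite -hnorm_sqr ler_pXn2r// nnegrE hnorm_ge0.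
Qed.

End Hilbert.

Arguments hnorm_ge0 {R V dot} x.

(** * Closed convex sets and the guarding lemma *)

Section Convexity.
Context {R : realType} {V : lmodType R} (dot : V -> V -> R).
Hypothesis hdot : hilbert dot.
Implicit Types (x y z u : V) (a b c : R).
Local Notation hnorm := (hnorm dot).
Definition hball (c : V) (r : R) : set V := [set p | hnorm (p - c) <= r].

Definition convex (K : set V) := forall x y t, K x -> K y ->
  0 <= t <= 1 -> K (x + t *: (y - x)).

(** Closedness for the norm, phrased by approximation because [V] carries no topology. *)
Definition dclosed (K : set V) := forall x,
  (forall eps : R, 0 < eps -> exists2 y, K y & hnorm (x - y) <= eps) -> K x.

Lemma convex_ball x r : convex (hball x r).
Proof.
move=> y z t; rewrite /hball/= => yr zr /andP[t0 t1].
have -> : y + t *: (z - y) - x = (1 - t) *: (y - x) + t *: (z - x).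
  by apply: (dot_ext hdot); rewrite !(dotE hdot); ring.
apply: le_trans (ler_hnormD hdot _ _) _; rewrite !(hnormZ hdot) !ger0_norm ?subr_ge0//.
have -> : r = (1 - t) * r + t * r by ring.
by apply: lerD; apply: ler_wpM2l => //; rewrite subr_ge0.
Qed.

Lemma dclosed_ball x r : dclosed (hball x r).
Proof.
move=> y h; rewrite /hball/=; apply/ler_addgt0Pr => eps /h[z /= zr yz].
by apply: le_trans (ler_hdistD hdot z _ _) _; rewrite addrC lerD.
Qed.

Definition halfspace u c : set V := [set z | dot z u <= c].

Lemma convex_halfspace u c : convex (halfspace u c).
Proof.
move=> y z t; rewrite /halfspace/= => yr zr /andP[t0 t1].
have -> : dot (y + t *: (z - y)) u = (1 - t) * dot y u + t * dot z u.
  by rewrite !(dotE hdot); ring.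
have -> : c = (1 - t) * c + t * c by ring.
by apply: lerD; apply: ler_wpM2l => //; rewrite subr_ge0.
Qed.

Lemma dclosed_halfspace u c : dclosed (halfspace u c).
Proof.
move=> y h; rewrite /halfspace/=; apply/ler_addgt0Pr => eps e0.
have d0 : 0 < eps / (hnorm u + 1).
  by rewrite divr_gt0// ltr_wpDl ?hnorm_ge0.
have [z /= zc yz] := h _ d0.
rewrite -(subrK z y) (dotDl hdot) addrC lerD//.
apply: le_trans (dot_le_hnorm hdot _ _) _.
have u1 : 0 < hnorm u + 1 by rewrite ltr_wpDl ?hnorm_ge0.
apply: le_trans (ler_wpM2r (hnorm_ge0 u) yz) _.
by rewrite mulrAC ler_pdivrMr// ler_pM2l// lerDl.
Qed.



(** The parallelogram law for [x - a] and [y - a], with the midpoint in the form that [convex]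
    produces. *)
Lemma parallelogram x y (a : V) : dot (x - y) (x - y) =
  2 * dot (x - a) (x - a) + 2 * dot (y - a) (y - a)
  - 4 * dot (x + 2^-1 *: (y - x) - a) (x + 2^-1 *: (y - x) - a).
Proof. by rewrite !(dotE hdot) (dotC hdot y x) (dotC hdot a x) (dotC hdot a y); field. Qed.

(* A minimizing sequence is Cauchy by the parallelogram identity. *)
Lemma nested_nearest_point (K : nat -> set V) (a : V) M :
  (forall n, convex (K n)) -> (forall n, dclosed (K n)) ->
  (forall n m, (n <= m)%N -> K m `<=` K n) ->
  (forall n, exists2 x, K n x & dot (x - a) (x - a) <= M) ->
  exists2 x, forall n, K n x &
    forall z, (forall n, K n z) -> hnorm (x - a) <= hnorm (z - a).
Proof.
move=> cvx cl decr ne.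
pose D n := [set dot (x - a) (x - a) | x in K n].
pose d n := inf (D n).
have D0 n : D n !=set0 by have [x Kx _] := ne n; exists (dot (x - a) (x - a)); exists x.
have Dlb n : lbound (D n) 0 by move=> _ [x _ <-]; exact: (dot_ge0 hdot).
have Di n : has_inf (D n) by split; [exact: D0|exists 0; exact: Dlb].
have d_le n x : K n x -> d n <= dot (x - a) (x - a).
  by move=> Kx; apply: ge_inf; [by case: (Di n)|exists x].
have dnd : {homo d : n m / (n <= m)%N >-> n <= m}.
  move=> n m nm; apply: lb_le_inf; first exact: D0.
  by move=> _ [x Kx <-]; apply: d_le; exact: decr nm _ Kx.
have dM n : d n <= M by have [x Kx] := ne n; apply: le_trans; exact: d_le.
have cd : cvgn d by apply: nondecreasing_is_cvgn => //; exists M => _ [n _ <-].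
pose l := limn d.
have dl n : d n <= l by exact: nondecreasing_cvgn_le.
have /choice[x xP] n : exists x, K n x /\ dot (x - a) (x - a) <= d n + n.+1%:R^-1.
  have e0 : 0 < n.+1%:R^-1 :> R by rewrite invr_gt0.
  have [_ [x Kx <-] xd] := inf_adherent e0 (Di n).
  by exists x; split=> //; exact: ltW.
(* For [n <= m] the midpoint of [x n] and [x m] lies in [K n], so its squared distance to [a] is at
   least [d n], while those of [x n] and [x m] are at most [d n + 1/(n+1)] and [l + 1/(n+1)]. The
   parallelogram law then yields this rate. *)
pose eta n := 2 * (l - d n) + 4 * n.+1%:R^-1.
have inv0 : (fun n => n.+1%:R^-1) @ \oo --> (0 : R) by exact: cvg_harmonic.
have eta0 : eta @ \oo --> (0 : R).
  have -> : (0 : R) = 2 * (l - l) + 4 * 0 by rewrite subrr !mulr0 addr0.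
  apply: cvgD; apply: cvgM; first [exact: cvg_cst|exact: inv0|idtac].
  by apply: cvgB => //; exact: cvg_cst.
have inv_le n m : (n <= m)%N -> m.+1%:R^-1 <= n.+1%:R^-1 :> R.
  by move=> nm; rewrite lef_pV2 ?posrE// ler_nat.
have xeta n m : (n <= m)%N -> dot (x m - x n) (x m - x n) <= eta n.
  move=> nm; rewrite (parallelogram _ _ a) /eta.
  have [Kn xn] := xP n; have [Km xm] := xP m.
  have /d_le : K n (x m + 2^-1 *: (x n - x m)).
    by apply: cvx => //; [exact: decr Km|lra].
  move: (inv_le _ _ nm) (dl m) xn xm.
  move: (_^-1) (_^-1) (dot _ _) (dot _ _) (dot _ _) => u v p q r; lra.
have [y xy] := dot_complete hdot eta0 xeta.
have sqrt_eta0 : (fun n => Num.sqrt (eta n)) @ \oo --> (0 : R).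
  by rewrite -sqrtr0; apply: (cvg_comp _ _ eta0); exact: sqrt_continuous.
have ny n : hnorm (y - x n) <= Num.sqrt (eta n).
  by rewrite /hnorm ler_wsqrtr.
exists y => [n|z Kz].
  apply: cl => e e0.
  have : \forall k \near \oo, Num.sqrt (eta k) < e by apply: (cvgr_lt 0).
  move=> [k _ /(_ (maxn n k))/=]; rewrite leq_maxr => /(_ isT) ke.
  exists (x (maxn n k)); first exact: decr (leq_maxl _ _) _ (xP _).1.
  exact: le_trans (ny _) (ltW ke).
have bnd n : hnorm (y - a) <= Num.sqrt (eta n) + Num.sqrt (hnorm (z - a) ^+ 2 + n.+1%:R^-1).
  apply: le_trans (ler_hdistD hdot (x n) _ _) _; apply: lerD => //.
  apply: ler_wsqrtr; rewrite (hnorm_sqr hdot); apply: le_trans (xP n).2 _.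
  by rewrite lerD2r; exact: d_le.
have lim : (fun n => Num.sqrt (eta n) + Num.sqrt (hnorm (z - a) ^+ 2 + n.+1%:R^-1)) @ \oo
    --> hnorm (z - a).
  rewrite -[X in _ --> X]add0r; apply: cvgD => //.
  rewrite -[X in _ --> X](ger0_norm (hnorm_ge0 _)) -sqrtr_sqr -[X in _ --> Num.sqrt X]addr0.
  apply: (cvg_comp _ Num.sqrt); last exact: sqrt_continuous.
  by apply: cvgD => //; exact: cvg_cst.
by apply: (cvgr_to_ge lim); exact: nearW.
Qed.

(** The variational inequality of the projection: if it failed at [z], a small step from [x] towards
    [z] would come strictly closer to [a]. *)
Lemma nearest_point (K : set V) (a : V) : convex K -> dclosed K -> K !=set0 ->
  exists2 x, K x & forall z, K z -> dot (x - a) (x - z) <= 0.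
Proof.
move=> cvx cl [x0 Kx0].
have ne : forall n : nat, exists2 x, K x & dot (x - a) (x - a) <= dot (x0 - a) (x0 - a).
  by move=> _; exists x0.
have [x Kx xmin] := nested_nearest_point (fun=> cvx) (fun=> cl) (fun n m _ => @subset_refl _ K) ne.
exists x; first exact: Kx 0%N.
move=> z Kz.
rewrite leNgt; apply/negP => h.
pose q := dot (x - z) (x - z).
have q0 : 0 < q.
  rewrite lt_neqAle (dot_ge0 hdot) andbT eq_sym; apply/negP => /eqP/(dot_eq0 hdot) xz.
  by move: h; rewrite xz -(scale0r (x - a)) (dotZr hdot) mul0r ltxx.
pose p := dot (x - a) (x - z).
(* A step [t] changes the squared distance by [- 2 t p + t^2 q]. With [t q <= p] this is at most
   [- t p], which is negative. *)
pose t := Num.min 1 (p / q).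
have t0 : 0 < t by rewrite lt_min ltr01 divr_gt0.
have t1 : t <= 1 by rewrite ge_min lexx.
have tq : t * q <= p by rewrite -ler_pdivlMr// ge_min lexx orbT.
have /xmin : forall n : nat, K (x + t *: (z - x)).
  move=> _; apply: cvx Kz _; first exact: Kx 0%N.
  by apply/andP; split; [exact: ltW|].
rewrite -(@ler_pXn2r _ 2) ?nnegrE ?hnorm_ge0// !(hnorm_sqr hdot).
have -> : dot (x + t *: (z - x) - a) (x + t *: (z - x) - a) =
   dot (x - a) (x - a) - 2 * t * p + t * (t * q).
  rewrite /p /q !(dotE hdot) (dotC hdot z x) (dotC hdot z a) (dotC hdot x a); ring.
have tp : 0 < t * p by exact: mulr_gt0.
have ttq : t * (t * q) <= t * p by rewrite ler_pM2l.
apply/negP; rewrite -ltNge; lra.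
Qed.

(* The invariant says that a player at [p] with reach [r] covers every point [m] of [K]
   with a margin that allows for the evader, at [y] with reach [rho], to use only part of
   its reach; it is linear in [m].  The new position is [p + (1 - s) (z - p)] with [z] the
   projection of [p + (y' - p) / (1 - s)] on the points of [K] still reachable from [y']. *)
Lemma guard_step (K : set V) y y' p rho r s :
  convex K -> dclosed K -> 0 <= s < 1 -> 0 <= rho -> 0 <= r ->
  hnorm (y' - y) <= rho - s ^+ 2 * rho ->
  (forall m, K m -> hnorm (m - y) <= rho ->
    hnorm (m - p) ^+ 2 - r ^+ 2 <= hnorm (m - y) ^+ 2 - rho ^+ 2) ->
  exists p', hnorm (p' - p) <= (1 - s) * r /\
    forall m, K m -> hnorm (m - y') <= s ^+ 2 * rho ->
      hnorm (m - p') ^+ 2 - (s * r) ^+ 2 <= hnorm (m - y') ^+ 2 - (s ^+ 2 * rho) ^+ 2.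
Proof.
move=> cvxK clK /andP[s0 s1] rho0 r0 yy' inv.
pose C := K `&` hball y' (s ^+ 2 * rho).
(* If no point of [K] remains within the evader's reach, there is nothing to guard and the player
   stays at [p]. *)
have [C0|CN0] := pselect (C !=set0); last first.
  exists p; split; first by rewrite subrr (hnorm0 hdot) mulr_ge0// subr_ge0 ltW.
  by move=> m Km my; exfalso; apply: CN0; exists m.
have cvxC : convex C.
  move=> u v t [Ku ru] [Kv rv] t01; split; [exact: cvxK|exact: convex_ball].
have clC : dclosed C.
  move=> u Cu; split; [apply: clK|apply: dclosed_ball] => e /Cu[v [? ?] ?]; by exists v.
have s1' : 1 - s != 0 by rewrite subr_eq0 eq_sym lt_eqF.
have [z [Kz zy'] zmin] :=
  nearest_point (p + (1 - s)^-1 *: (y' - p)) cvxC clC C0.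
set d' := hnorm (z - y') in zy'; pose d := hnorm (z - y).
have d'0 : 0 <= d' by exact: hnorm_ge0.
have d0 : 0 <= d by exact: hnorm_ge0.
have dd' : d <= d' + (rho - s ^+ 2 * rho).
  by apply: le_trans (ler_hdistD hdot y' _ _) _; rewrite lerD2l.
have s21 : s ^+ 2 <= 1 by rewrite expr_le1// ltW.
have drho : d <= rho by rewrite /hball/= -/d' in zy'; lra.
have zp := inv z Kz drho; rewrite -/d in zp.
have zpr : hnorm (z - p) <= r.
  rewrite -(@ler_pXn2r _ 2) ?nnegrE ?hnorm_ge0// -subr_le0.
  by apply: le_trans zp _; rewrite subr_le0 ler_pXn2r.
(* This is the new invariant at [m = z], where the distance to the new position is [s] times
   [hnorm (z - p)]. The slack is exactly the square in [e2]; it comes out this way because the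
   evader's reach is scaled by [s ^+ 2] and the player's by [s]. *)
have key : s ^+ 2 * hnorm (z - p) ^+ 2 - (s * r) ^+ 2 <= d' ^+ 2 - (s ^+ 2 * rho) ^+ 2.
  have e1 : d ^+ 2 <= (d' + (rho - s ^+ 2 * rho)) ^+ 2 by rewrite ler_pXn2r ?nnegrE//; lra.
  have e2 : 0 <= (1 - s ^+ 2) * (s ^+ 2 * rho - d') ^+ 2 by rewrite mulr_ge0 ?sqr_ge0 ?subr_ge0.
  have e3 : s ^+ 2 * (hnorm (z - p) ^+ 2 - r ^+ 2) <=
      s ^+ 2 * ((d' + (rho - s ^+ 2 * rho)) ^+ 2 - rho ^+ 2).
    by rewrite ler_wpM2l ?sqr_ge0//; lra.
  have -> : s ^+ 2 * hnorm (z - p) ^+ 2 - (s * r) ^+ 2 =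
    s ^+ 2 * (hnorm (z - p) ^+ 2 - r ^+ 2) by ring.
  apply: le_trans e3 _; rewrite -subr_ge0; move: e2; congr (_ <= _); ring.
exists (p + (1 - s) *: (z - p)); split.
  have -> : p + (1 - s) *: (z - p) - p = (1 - s) *: (z - p).
    by apply: (dot_ext hdot); rewrite !(dotE hdot); ring.
  by rewrite (hnormZ hdot) gtr0_norm ?ler_pM2l ?subr_gt0.
move=> m Km my.
have := zmin m (conj Km my).
rewrite -(pmulr_rle0 _ (_ : 0 < 2 * (1 - s))) ?mulr_gt0 ?subr_gt0// => lin.
(* The difference of squared distances is affine in [m]: it is its value at [z], bounded by [key],
   plus a term that is nonpositive by the choice of [z]. *)
have id : hnorm (m - (p + (1 - s) *: (z - p))) ^+ 2 - hnorm (m - y') ^+ 2 =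
    s ^+ 2 * hnorm (z - p) ^+ 2 - d' ^+ 2 +
    2 * (1 - s) * dot (z - (p + (1 - s)^-1 *: (y' - p))) (z - m).
  rewrite !(hnorm_sqr hdot) !(dotE hdot) (dotC hdot p m) (dotC hdot z m)
    (dotC hdot y' m) (dotC hdot z p) ?(dotC hdot y' p) ?(dotC hdot y' z).
  by field.
lra.
Qed.


(** The points whose power with respect to the ball around [p] is at most their power with respect
    to the ball around [e]. The quadratic terms cancel, which makes this a (possibly degenerate)
    half-space. *)
Definition bisector (e : V) (rho : R) (p : V) (r : R) : set V :=
  [set m | hnorm (m - p) ^+ 2 - r ^+ 2 <= hnorm (m - e) ^+ 2 - rho ^+ 2].

Lemma bisectorE (e : V) rho p r : bisector e rho p r =
  halfspace (e - p) ((r ^+ 2 - rho ^+ 2 - dot p p + dot e e) / 2).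
Proof.
apply/seteqP; split=> m; rewrite /bisector /halfspace/= !(hnorm_sqr hdot) !(dotE hdot);
  rewrite (dotC hdot p m) (dotC hdot e m); lra.
Qed.

Lemma convex_bisector (e : V) rho p r : convex (bisector e rho p r).
Proof. rewrite bisectorE; exact: convex_halfspace. Qed.

Lemma dclosed_bisector (e : V) rho p r : dclosed (bisector e rho p r).
Proof. rewrite bisectorE; exact: dclosed_halfspace. Qed.

(** [s] is the larger root of a quadratic whose value at 0 is nonpositive, since [z] lies in the
    ball. *)
Lemma push_to_sphere (e : V) rho z (g : V) : g <> 0 -> hnorm (z - e) <= rho ->
  exists2 s, 0 <= s & hnorm (z + s *: g - e) = rho.
Proof.
move=> g0 zr; have rho0 : 0 <= rho := le_trans (hnorm_ge0 _) zr.
have G0 : 0 < dot g g.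
  by rewrite lt_neqAle (dot_ge0 hdot) andbT eq_sym; apply/eqP => /(dot_eq0 hdot).
set G := dot g g in G0; pose b := dot (z - e) g.
have c0 : 0 <= rho ^+ 2 - dot (z - e) (z - e).
  by rewrite subr_ge0 -(hnorm_sqr hdot) ler_pXn2r ?nnegrE ?hnorm_ge0.
pose D := b ^+ 2 + G * (rho ^+ 2 - dot (z - e) (z - e)).
have D0 : 0 <= D by rewrite addr_ge0 ?sqr_ge0// mulr_ge0// ltW.
have bD : b <= Num.sqrt D.
  apply: le_trans (ler_norm b) _; rewrite -sqrtr_sqr; apply: ler_wsqrtr.
  by rewrite lerDl mulr_ge0// ltW.
exists ((Num.sqrt D - b) / G); first by rewrite divr_ge0 ?subr_ge0// ltW.
apply/eqP; rewrite -(@eqrXn2 _ 2) ?hnorm_ge0// (hnorm_sqr hdot); apply/eqP.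
set s := (Num.sqrt D - b) / G.
have -> : dot (z + s *: g - e) (z + s *: g - e) = dot (z - e) (z - e) + 2 * s * b + s ^+ 2 * G.
  by rewrite /b /G !(dotE hdot) (dotC hdot g z) (dotC hdot e z) (dotC hdot g e); ring.
have sG : s * G = Num.sqrt D - b by rewrite /s divfK// gt_eqF.
have DE : Num.sqrt D ^+ 2 = D by rewrite sqr_sqrtr.
apply: (@mulIf _ G); first by rewrite gt_eqF.
have -> : (dot (z - e) (z - e) + 2 * s * b + s ^+ 2 * G) * G =
  dot (z - e) (z - e) * G + 2 * (s * G) * b + (s * G) ^+ 2 by ring.
rewrite sG; have -> : dot (z - e) (z - e) * G + 2 * (Num.sqrt D - b) * b + (Num.sqrt D - b) ^+ 2
  = dot (z - e) (z - e) * G - b ^+ 2 + Num.sqrt D ^+ 2 by ring.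
by rewrite DE /D; ring.
Qed.

(** Along [g] the difference of squared distances is affine with slope [2 * dot (e - p) g]. *)
Lemma push_bisector (e : V) z p (g : V) s : 0 <= s -> 0 <= dot (e - p) g ->
  hnorm (z - p) ^+ 2 - hnorm (z - e) ^+ 2 <=
  hnorm (z + s *: g - p) ^+ 2 - hnorm (z + s *: g - e) ^+ 2.
Proof.
move=> s0 h; rewrite -subr_ge0 !(hnorm_sqr hdot).
have -> : dot (z + s *: g - p) (z + s *: g - p) - dot (z + s *: g - e) (z + s *: g - e) -
   (dot (z - p) (z - p) - dot (z - e) (z - e)) = 2 * (s * dot (e - p) g).
  by rewrite !(dotE hdot) (dotC hdot g p) (dotC hdot g e); ring.
by rewrite !mulr_ge0.
Qed.

(** * Coverings of the evader's ball by balls and by half-spaces *)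

Section Covering.
Variables (e : V) (rho : R) (p : nat -> V) (r : nat -> R) (g : V).
Hypotheses (g0 : g <> 0) (pg : forall j, 0 <= dot (e - p j) g).
Hypotheses (r0 : forall j, 0 <= r j).

(** The index is that of a ball containing the pushed point. On the sphere, lying in that ball means
    lying in its half-space, and [push_bisector] carries this back to [z]. *)
Lemma covered_bisector z : hball e rho `<=` \bigcup_j hball (p j) (r j) ->
  hball e rho z -> exists j, bisector e rho (p j) (r j) z.
Proof.
move=> cover zr; have [s s0 zs] := push_to_sphere g0 zr.
have [|j _ zj] := cover (z + s *: g); first by rewrite /hball/= zs.
exists j; rewrite /bisector/=.
have := push_bisector z s0 (pg j); rewrite zs => h.
have : hnorm (z + s *: g - p j) ^+ 2 <= r j ^+ 2.
  by rewrite ler_pXn2r ?nnegrE ?hnorm_ge0.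
lra.
Qed.

(* Points of the ball that are far from every [p j] satisfy linear constraints, which
   pass to the limit by weak compactness; pushing along [g] to the sphere turns the
   limiting constraints back into distance estimates. *)
Lemma exists_far_point phi : 0 <= rho -> 0 <= phi ->
  (forall eps, 0 <= eps < phi -> ~ (hball e rho `<=` \bigcup_j hball (p j) (r j + eps))) ->
  exists2 x, hball e rho x & forall j q, hnorm (q - p j) <= r j -> phi <= hnorm (q - x).
Proof.
move=> rho0; rewrite le_eqVlt => /predU1P[<- _|phi0 far].
  by exists e => [|j q _]; rewrite /hball/= ?subrr ?(hnorm0 hdot)// hnorm_ge0.
(* Levels strictly below [phi], at which covering fails, increasing to [phi]. *)
pose eps n : R := phi * (1 - n.+1%:R^-1).
have inv01 n : 0 < (n.+1%:R^-1 : R) <= 1 by rewrite invr_gt0 ltr0Sn invf_le1 ?ler1n.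
have eps_lt n : 0 <= eps n < phi.
  have /andP[i0 i1] := inv01 n; apply/andP; split.
    by rewrite mulr_ge0 ?subr_ge0// ltW.
  by rewrite gtr_pMr// gtrBl.
have eps_mono n m : (n <= m)%N -> eps n <= eps m.
  by move=> nm; rewrite /eps ler_pM2l// lerD2l lerN2 lef_pV2 ?posrE// ler_nat.
(* The two balls exchange roles in [bisector]: an uncovered point of the ball around [e] satisfies
   these constraints for all [j], and, unlike lower bounds on distances, they are convex. *)
pose K n := hball e rho `&` \bigcap_j bisector (p j) (r j + eps n) e rho.
have cvxK n : convex (K n).
  move=> u v t [u1 u2] [v1 v2] t01; split; first exact: convex_ball.
  move=> j _; apply: convex_bisector => //; [exact: u2|exact: v2].
have clK n : dclosed (K n).
  move=> u Ku; split; first by apply: dclosed_ball => d /Ku[v [? _] ?]; exists v.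
  by move=> j _; apply: dclosed_bisector => d /Ku[v [_ hv] ?]; exists v => //; exact: hv.
have decrK n m : (n <= m)%N -> K m `<=` K n.
  move=> nm u [u1 u2]; split => // j _; have := u2 j I; rewrite /bisector/=.
  have : (r j + eps n) ^+ 2 <= (r j + eps m) ^+ 2.
    have /andP[n0 _] := eps_lt n; have /andP[m0 _] := eps_lt m.
    by rewrite ler_pXn2r ?nnegrE ?addr_ge0// lerD2l eps_mono.
  lra.
have neK n : exists2 x, K n x & dot (x - e) (x - e) <= rho ^+ 2.
  have /existsNP[w /not_implyP[wr wN]] := far _ (eps_lt n).
  have wr2 : hnorm (w - e) ^+ 2 <= rho ^+ 2 by rewrite ler_pXn2r ?nnegrE ?hnorm_ge0.
  exists w; last by rewrite -(hnorm_sqr hdot).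
  split=> // j _; rewrite /bisector/=.
  have : (r j + eps n) ^+ 2 <= hnorm (w - p j) ^+ 2.
    have /andP[n0 _] := eps_lt n.
    rewrite ler_pXn2r ?nnegrE ?hnorm_ge0 ?addr_ge0// leNgt; apply/negP => h.
    by apply: wN; exists j => //; exact: ltW.
  lra.
(* Weak compactness enters here: nested closed convex sets, all meeting a fixed ball, have a common
   point. Its minimality is irrelevant. *)
have [x Kx _] := nested_nearest_point cvxK clK decrK neK.
have xr : hball e rho x by case: (Kx 0%N).
have [s s0 xs] := push_to_sphere g0 xr.
exists (x + s *: g); first by rewrite /hball/= xs.
move=> j q qj.
have far_n n : r j + eps n <= hnorm (x + s *: g - p j).
  have /andP[n0 _] := eps_lt n.
  rewrite -(@ler_pXn2r _ 2) ?nnegrE ?hnorm_ge0 ?addr_ge0//.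
  have [_ /(_ j I)] := Kx n; have := push_bisector x s0 (pg j).
  rewrite /bisector/= xs; lra.
have : r j + phi <= hnorm (x + s *: g - p j).
  have lim : (fun n => r j + eps n) @ \oo --> r j + phi.
    have -> : r j + phi = r j + phi * (1 - 0) by ring.
    apply: cvgD; first exact: cvg_cst.
    apply: cvgM; first exact: cvg_cst.
    by apply: cvgB; [exact: cvg_cst|exact: cvg_harmonic].
  by apply: (cvgr_to_le lim); exact: nearW.
have := ler_hdistD hdot q (x + s *: g) (p j); rewrite (hdistC hdot _ q); lra.
Qed.

End Covering.

End Convexity.

(** * Integral curves in l2 *)

Section VectorIntegrals.
Context {R : realType}.
Local Notation mu := (@lebesgue_measure R).
Implicit Types (x y z : l2 R) (D : set (measurableTypeR R)) (t s tau : R).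

Lemma l2norm_ge0 x : 0 <= l2norm x. Proof. exact: sqrtr_ge0. Qed.

Lemma sqr_sum_mul_le (a b : nat -> R) n :
  (\sum_(i < n) a i * b i) ^+ 2 <= (\sum_(i < n) a i ^+ 2) * (\sum_(i < n) b i ^+ 2).
Proof.
set P := \sum_(i < n) a i * b i; set A := \sum_(i < n) a i ^+ 2.
set B := \sum_(i < n) b i ^+ 2.
have B0 : 0 <= B by apply: sumr_ge0 => i _; exact: sqr_ge0.
have : 0 <= \sum_(i < n) (B * a i - P * b i) ^+ 2.
  by apply: sumr_ge0 => i _; exact: sqr_ge0.
have -> : \sum_(i < n) (B * a i - P * b i) ^+ 2 = B * (A * B - P ^+ 2).
  have E i : (B * a i - P * b i) ^+ 2 =
    B ^+ 2 * a i ^+ 2 + (- 2 * B * P) * (a i * b i) + P ^+ 2 * b i ^+ 2 by ring.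
  under eq_bigr do rewrite E.
  rewrite !big_split/= -!mulr_sumr -/A -/B -/P; ring.
move: B0; rewrite le_eqVlt => /predU1P[B0 _|B0].
  have b0 (i : 'I_n) : b i = 0.
    apply/eqP; rewrite -sqrf_eq0 eq_le sqr_ge0 andbT B0 /B (bigD1 i)//=.
    by rewrite lerDl sumr_ge0// => j _; exact: sqr_ge0.
  rewrite -B0 mulr0 /P big1 ?expr0n// => i _; by rewrite b0 mulr0.
by rewrite pmulr_rge0// subr_ge0.
Qed.

Lemma Rintegral_lincomb D (c : nat -> R) (f : nat -> R -> R) n : measurable D ->
  (forall i, mu.-integrable D (EFin \o f i)) ->
  mu.-integrable D (EFin \o (fun s => \sum_(i < n) c i * f i s)) /\
  \int[mu]_(s in D) (\sum_(i < n) c i * f i s) =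
  \sum_(i < n) c i * \int[mu]_(s in D) f i s.
Proof.
move=> mD intf; elim: n => [|n [IH1 IH2]].
  split; last by under eq_Rintegral do rewrite big_ord0; rewrite big_ord0 Rintegral_cst// mul0r.
    by apply: (eq_integrable mD _ _ _ (integrable0 mu D)) => // s _; rewrite /= big_ord0.
have icf : mu.-integrable D (EFin \o (fun s => c n * f n s)).
  apply: (eq_integrable mD _ _ _ (integrableZl mD (c n) (intf n))) => //.
split.
  apply: (eq_integrable mD _ _ _ (integrableD mD IH1 icf)) => // s _.
  by rewrite /= big_ord_recr.
under eq_Rintegral do rewrite big_ord_recr/=.
by rewrite RintegralD// IH2 RintegralZl// big_ord_recr.
Qed.

(** With [w] the vector of integrals, its squared length [S] is the integral of the sum of the
    [w i * f s i], hence at most [Num.sqrt S] times the integral of [g] by Cauchy-Schwarz. Working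
    with finitely many coordinates makes this available before the integral is known to lie in
    l2. *)
Lemma sum_sqr_Rintegral_le D (f : R -> l2 R) (g : R -> R) n : measurable D ->
  (forall i, mu.-integrable D (fun s => (f s i : R)%:E)) ->
  mu.-integrable D (EFin \o g) -> (forall s, D s -> l2norm (f s) <= g s) ->
  \sum_(i < n) (\int[mu]_(s in D) (f s i : R)) ^+ 2 <= (\int[mu]_(s in D) g s) ^+ 2.
Proof.
move=> mD intf intg fg.
pose w i := \int[mu]_(s in D) (f s i : R).
rewrite -/(w _); set S := \sum_(i < n) w i ^+ 2; set G := \int[mu]_(s in D) g s.
have S0 : 0 <= S by apply: sumr_ge0 => i _; exact: sqr_ge0.
have [iwf wfE] := Rintegral_lincomb w n mD intf.
have SG : S <= Num.sqrt S * G.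
  have SE : S = \int[mu]_(s in D) (\sum_(i < n) w i * f s i).
    by rewrite wfE; apply: eq_bigr => i _; rewrite expr2.
  rewrite {1}SE -RintegralZl//; apply: le_Rintegral => //.
    apply: (eq_integrable mD _ _ _ (integrableZl mD (Num.sqrt S) intg)) => //.
  move=> s Ds; apply: le_trans (ler_norm _) _; rewrite -sqrtr_sqr.
  apply: le_trans (ler_wsqrtr (sqr_sum_mul_le _ _ _)) _.
  rewrite sqrtrM// ler_wpM2l ?sqrtr_ge0//; apply: le_trans (fg s Ds).
  by apply: ler_wsqrtr; exact: sum_sqr_le_l2dot.
have [S00|SN0] := eqVneq S 0; first by rewrite S00 sqr_ge0.
have sS : 0 < Num.sqrt S by rewrite sqrtr_gt0 lt_neqAle eq_sym SN0.
have : Num.sqrt S <= G.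
  by rewrite -(ler_pM2l sS) -expr2 sqr_sqrtr.
move=> SG'; rewrite -(sqr_sqrtr S0) ler_pXn2r ?nnegrE ?sqrtr_ge0//.
exact: le_trans (sqrtr_ge0 _) SG'.
Qed.

Lemma exists_l2_Rintegral D (f : R -> l2 R) (g : R -> R) : measurable D ->
  (forall i, mu.-integrable D (fun s => (f s i : R)%:E)) ->
  mu.-integrable D (EFin \o g) -> (forall s, D s -> l2norm (f s) <= g s) ->
  exists w : l2 R, forall i, w i = \int[mu]_(s in D) (f s i : R).
Proof.
move=> mD intf intg fg.
by apply: exists_l2 => n; exact: sum_sqr_Rintegral_le mD intf intg fg.
Qed.

Lemma l2norm_Rintegral_le D (f : R -> l2 R) (g : R -> R) (w : l2 R) : measurable D ->
  (forall i, mu.-integrable D (fun s => (f s i : R)%:E)) ->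
  mu.-integrable D (EFin \o g) -> (forall s, D s -> l2norm (f s) <= g s) ->
  (forall i, w i = \int[mu]_(s in D) (f s i : R)) ->
  l2norm w <= \int[mu]_(s in D) g s.
Proof.
move=> mD intf intg fg wE; apply: (ler_hnorm l2_hilbert).
  by apply: Rintegral_ge0 => s Ds; apply: le_trans (fg s Ds); exact: l2norm_ge0.
apply: l2dot_le => n; under eq_bigr do rewrite wE.
exact: sum_sqr_Rintegral_le mD intf intg fg.
Qed.

Lemma bounded_integrable D (f : R -> R) M : measurable D -> (mu D < +oo)%E ->
  measurable_fun D f -> (forall s, D s -> `|f s| <= M) -> mu.-integrable D (EFin \o f).
Proof.
move=> mD fD mf fM; apply: measurable_bounded_integrable => //.
exists M; split; first exact: num_real.
by move=> N MN s /= Ds; apply: le_trans (fM s Ds) (ltW MN).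
Qed.

Lemma mu_itv_fin (b1 b2 : bool) (t t' : R) :
  (mu [set` Interval (BSide b1 t) (BSide b2 t')] < +oo)%E.
Proof.
have := lebesgue_measure_itv (Interval (BSide b1 t) (BSide b2 t')) => /= ->.
by case: ifPn => // _; rewrite -EFinB ltry.
Qed.

Lemma Rintegral_itv_cst (b1 b2 : bool) (t t' c : R) : t <= t' ->
  \int[mu]_(s in [set` Interval (BSide b1 t) (BSide b2 t')]) c = c * (t' - t).
Proof.
move=> tt'; rewrite Rintegral_cst//; congr (_ * _).
have := lebesgue_measure_itv (Interval (BSide b1 t) (BSide b2 t')) => /= ->.
rewrite lte_fin; case: ltP => [//|t't]; rewrite (_ : t' = t) ?subrr//.
by apply/eqP; rewrite eq_le tt' t't.
Qed.

Lemma integrable_itv_sub (c t t' : R) :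
  mu.-integrable `[t, t'] (EFin \o (fun s : R => s - c)).
Proof.
apply: continuous_compact_integrable; first exact: segment_compact.
apply: continuous_subspaceT => s; apply: cvgB; [exact: cvg_id|exact: cvg_cst].
Qed.

Lemma Rintegral_itv_sub (t t' : R) : t <= t' ->
  \int[mu]_(s in `]t, t']) (s - t) = (t' - t) ^+ 2 / 2.
Proof.
rewrite le_eqVlt => /predU1P[<-|tt'].
  by rewrite set_itvoc0 Rintegral_set0 subrr expr0n mul0r.
have ci := integrable_itv_sub t t t'.
rewrite Rintegral_itv_obnd_cbnd; last first.
  by apply: integrableS ci => //; apply: subset_itvr; rewrite bnd_simp.
pose F (s : R) : R := (s - t) ^+ 2 / 2.
have dF (s : R) : is_derive s 1 F (s - t).
  have h : is_derive s 1 (((@id R) - cst t) ^+ 2) (2%:R * (s - t) ^+ 1 * (1 - 0)).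
    by apply: is_derive_eq.
  have -> : F = (2^-1 : R) \*: (((@id R) - cst t) ^+ 2).
    by apply/funext => u; rewrite /F mulrC.
  apply: is_derive_eq; rewrite /GRing.scale/= expr1 subr0; by field.
rewrite /Rintegral (@continuous_FTC2 _ _ F) //=.
- by rewrite /F subrr expr0n mul0r subr0.
- by apply: continuous_subspaceT => s; apply: cvgB; [exact: cvg_id|exact: cvg_cst].
- have cF : continuous F.
    by move=> s; apply: differentiable_continuous; apply/derivable1_diffP; case: (dF s).
  by split; [move=> s _; case: (dF s)|exact/cvg_at_right_filter/cF|exact/cvg_at_left_filter/cF].
- by move=> s _; rewrite derive1E; apply: derive_val.
Qed.

End VectorIntegrals.

Section L2Norm.
Context {R : realType}.
Implicit Types (x y z : l2 R).

Lemma l2norm0 : l2norm (0 : l2 R) = 0. Proof. exact: (hnorm0 l2_hilbert). Qed.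
Lemma l2normZ (a : R) x : l2norm (a *: x) = `|a| * l2norm x.
Proof. exact: (hnormZ l2_hilbert). Qed.
Lemma l2distC x y : l2norm (x - y) = l2norm (y - x).
Proof. exact: (hdistC l2_hilbert). Qed.
Lemma ler_l2normD x y : l2norm (x + y) <= l2norm x + l2norm y.
Proof. exact: (ler_hnormD l2_hilbert). Qed.
Lemma ler_l2distD z x y : l2norm (x - y) <= l2norm (x - z) + l2norm (z - y).
Proof. exact: (ler_hdistD l2_hilbert). Qed.
Lemma coord_le_l2norm x i : `|x i : R| <= l2norm x.
Proof. by rewrite -sqrtr_sqr; apply: ler_wsqrtr; exact: coord_sqr_le. Qed.
End L2Norm.

Section Curves.
Context {R : realType}.
Local Notation mu := (@lebesgue_measure R).
Implicit Types (f x y b v e : R -> l2 R) (t s tau M : R).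

Lemma integral_curve_restrict tau tau' (x0 : l2 R) f x : tau' <= tau ->
  integral_curve tau x0 f x -> integral_curve tau' x0 f x.
Proof.
move=> tt' xP i; have [fi xi] := xP i; split.
  by apply: integrableS fi => //; apply: subset_itvl; rewrite bnd_simp.
by move=> t /andP[t0 tt]; apply: xi; rewrite t0 (le_trans tt tt').
Qed.

Lemma integral_curve_init tau (x0 : l2 R) f x : 0 <= tau -> integral_curve tau x0 f x -> x 0 = x0.
Proof.
move=> tau0 xP; apply: l2P => i; have [_ xi] := xP i.
by rewrite xi ?lexx ?tau0// set_itv1 Rintegral_set1 addr0.
Qed.

Lemma integral_curve_incr tau (x0 : l2 R) f x t t' i : integral_curve tau x0 f x ->
  0 <= t -> t <= t' -> t' <= tau ->
  (x t' - x t) i = \int[mu]_(s in `]t, t']) (f s i : R).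
Proof.
move=> xP t0 tt' t'tau; have [fi xi] := xP i.
rewrite coordD coordN !xi ?t0 ?(le_trans tt' t'tau) ?(le_trans t0 tt')//.
rewrite opprD addrACA subrr add0r Rintegral_itvB ?bnd_simp//.
by apply: integrableS fi => //; apply: subset_itvl; rewrite bnd_simp.
Qed.

Lemma integral_curve_ext tau (x0 : l2 R) f (f' : R -> l2 R) x :
  (forall s, 0 <= s <= tau -> f s = f' s) ->
  integral_curve tau x0 f x -> integral_curve tau x0 f' x.
Proof.
move=> ff' xP i; have [fi xi] := xP i; split.
  apply: eq_integrable fi => // s; rewrite inE/= in_itv/= => s0; by rewrite ff'.
move=> t /andP[t0 tt]; rewrite xi ?t0//; congr (_ + _); apply: eq_Rintegral => s.
rewrite inE/= in_itv/= => /andP[s0 st]; by rewrite ff'// s0 (le_trans st tt).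
Qed.

Lemma integral_curve_unique tau (x0 : l2 R) f x y : integral_curve tau x0 f x ->
  integral_curve tau x0 f y -> forall t, 0 <= t <= tau -> x t = y t.
Proof.
move=> xP yP t tt; apply: l2P => i.
by have [_ ->//] := xP i; have [_ ->//] := yP i.
Qed.

Lemma integral_curve_lipschitz tau (x0 : l2 R) f x M t t' : integral_curve tau x0 f x ->
  0 <= t -> t <= t' -> t' <= tau -> (forall s, t < s <= t' -> l2norm (f s) <= M) ->
  l2norm (x t' - x t) <= M * (t' - t).
Proof.
move=> xP t0 tt' t'tau fM.
rewrite -(Rintegral_itv_cst false false M tt').
apply: (@l2norm_Rintegral_le _ `]t, t']%classic f (cst M)) => //.
- move=> i; have [fi _] := xP i; apply: integrableS fi => //.
  by move=> s /=; rewrite !in_itv/= => /andP[ts st]; rewrite (le_trans t0 (ltW ts)) (le_trans st).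
- apply: (@bounded_integrable _ _ _ `|M|) => //; exact: mu_itv_fin.
- move=> i; exact: (integral_curve_incr i xP).
Qed.

Lemma bounded_l2_integrable tau f M i : measurable_fun `[0, tau] (fun t => f t i : R) ->
  (forall t, 0 <= t <= tau -> l2norm (f t) <= M) ->
  mu.-integrable `[0, tau] (fun s => (f s i : R)%:E).
Proof.
move=> mf fM; apply: (@bounded_integrable _ _ _ M) => //; first exact: mu_itv_fin.
move=> s /=; rewrite in_itv/= => st; apply: le_trans (fM s st); exact: coord_le_l2norm.
Qed.

Lemma exists_integral_curve tau (x0 : l2 R) f M :
  (forall i, measurable_fun `[0, tau] (fun t => f t i : R)) ->
  (forall t, 0 <= t <= tau -> l2norm (f t) <= M) ->
  exists x, integral_curve tau x0 f x.
Proof.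
move=> mf fM.
have intf i := bounded_l2_integrable (mf i) fM.
have /choice[x xE] t : exists w : l2 R, 0 <= t <= tau ->
    forall i, w i = \int[mu]_(s in `[0, t]) (f s i : R).
  have [/andP[t0 tt]|_] := boolP (0 <= t <= tau); last by exists 0.
  have sub : `[0, t]%classic `<=` `[0, tau]%classic by apply: subset_itvl; rewrite bnd_simp.
  have [||||w wE] := @exists_l2_Rintegral _ `[0, t]%classic f (cst M).
  - by [].
  - by move=> i; apply: integrableS (intf i).
  - by apply: (@bounded_integrable _ _ _ `|M|) => //; exact: mu_itv_fin.
  - move=> s /sub/=; rewrite in_itv/=; exact: fM.
  by exists w.
exists (fun t => x0 + x t) => i; split; first exact: intf.
by move=> t tt; rewrite coordD xE.
Qed.

(** Needed to integrate twice: the velocity, itself an integral curve, becomes the integrand for the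
    position. *)
Lemma integral_curve_measurable tau (x0 : l2 R) f x i : 0 <= tau -> integral_curve tau x0 f x ->
  measurable_fun `[0, tau] (fun t => x t i : R).
Proof.
move=> tau0 xP; have [fi xi] := xP i.
apply: (@eq_measurable_fun _ _ _ _ _ (fun t => x0 i + \int[mu]_(s in `[0, t]) (f s i : R))).
  by move=> t; rewrite inE/= in_itv/= => tt; rewrite xi.
apply: measurable_funD => //.
apply: subspace_continuous_measurable_fun => //.
exact: parameterized_integral_continuous fi.
Qed.

End Curves.

(** * The second-order motion of the evader *)

Section SecondOrder.
Context {R : realType}.
Local Notation mu := (@lebesgue_measure R).
Implicit Types (f x y b v e p : R -> l2 R) (t s tau M beta theta : R).

(** Formally the predicted final position [e t + (theta - t) *: v t] has velocity
    [(theta - t) *: b t]. Instead of differentiating, the increment is split into the integral of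
    [v s - v t] over the step and [(theta - t') *: (v t' - v t)]; the two bounds add up to the
    stated one. *)
Lemma drift_lipschitz tau theta (p0 q0 : l2 R) b v e beta t t' : 0 <= beta ->
  integral_curve tau q0 b v -> integral_curve tau p0 v e ->
  0 <= t -> t <= t' -> t' <= tau -> tau <= theta ->
  (forall s, t < s <= t' -> l2norm (b s) <= beta) ->
  l2norm (e t' + (theta - t') *: v t' - (e t + (theta - t) *: v t)) <=
  beta * ((theta - t) ^+ 2 / 2) - beta * ((theta - t') ^+ 2 / 2).
Proof.
move=> beta0 vP eP t0 tt' t'tau tautheta bM.
have vlip s : t <= s -> s <= t' -> l2norm (v s - v t) <= beta * (s - t).
  move=> ts st'; apply: (integral_curve_lipschitz vP) => //; first exact: le_trans t'tau.
  by move=> r /andP[tr rs]; apply: bM; rewrite tr (le_trans rs).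
set w := e t' - e t - (t' - t) *: v t.
have -> : e t' + (theta - t') *: v t' - (e t + (theta - t) *: v t) =
    w + (theta - t') *: (v t' - v t).
  by apply: l2P => i; rewrite !(coordD, coordN, coordZ); ring.
apply: le_trans (ler_l2normD _ _) _; rewrite l2normZ ger0_norm ?subr_ge0 ?(le_trans t'tau)//.
have iv i : mu.-integrable `]t, t'] (fun s => (v s i : R)%:E).
  have [vi _] := eP i; apply: integrableS vi => //.
  by move=> s /=; rewrite !in_itv/= => /andP[ts st]; rewrite (le_trans t0 (ltW ts)) (le_trans st).
have ic (c : R) : mu.-integrable `]t, t'] (EFin \o cst c).
  by apply: (@bounded_integrable _ _ _ `|c|) => //; exact: mu_itv_fin.
have is_ : mu.-integrable `]t, t'] (EFin \o (fun s : R => s - t)).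
  by apply: integrableS (integrable_itv_sub t t t') => //; apply: subset_itvr; rewrite bnd_simp.
have mI : measurable (`]t, t']%classic : set (measurableTypeR R)) by [].
have wle : l2norm w <= beta * ((t' - t) ^+ 2 / 2).
  rewrite -(Rintegral_itv_sub tt') -RintegralZl//.
  apply: (@l2norm_Rintegral_le _ `]t, t']%classic (fun s => v s - v t)) => //.
  - move=> i; apply: (eq_integrable mI _ _ _ (integrableB mI (iv i) (ic (v t i)))) => s _.
    by rewrite /= -EFinB.
  - by apply: (eq_integrable mI _ _ _ (integrableZl mI beta is_)) => s _; rewrite /= EFinM.
  - by move=> s /=; rewrite in_itv/= => /andP[ts st]; apply: vlip => //; exact: ltW.
  - move=> i; under eq_Rintegral do rewrite coordD coordN.
    apply: etrans (esym (RintegralB mI (iv i) (ic (v t i)))).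
    rewrite (Rintegral_itv_cst false false (v t i) tt').
    by rewrite -(integral_curve_incr i eP)// /w !(coordD, coordN, coordZ) mulrC.
have := vlip t' tt' (lexx _); set V := l2norm (v t' - v t) => Vle.
have : (theta - t') * V <= (theta - t') * (beta * (t' - t)).
  by apply: ler_wpM2l => //; rewrite subr_ge0 (le_trans t'tau).
by move: wle; lra.
Qed.

(** The iterated integral stands for that of [(theta - t) b(t)]. The final position depends only on
    the drift point and on [b], which are data known to a pursuer strategy. *)
Lemma second_order_terminal theta (p0 q0 : l2 R) b e i : 0 <= theta ->
  second_order_curve theta p0 q0 b e ->
  e theta i = evader_drift theta p0 q0 i +
    \int[mu]_(s in `[0, theta]) \int[mu]_(r in `[0, s]) (b r i : R).
Proof.
move=> theta0 [v vP eP]; have [vi ei] := eP i; have [_ bi] := vP i.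
rewrite ei ?theta0 ?lexx// /evader_drift coordD coordZ -addrA; congr (_ + _).
have ic (c : R) : mu.-integrable `[0, theta] (EFin \o cst c).
  by apply: (@bounded_integrable _ _ _ `|c|) => //; exact: mu_itv_fin.
transitivity (\int[mu]_(s in `[0, theta]) (q0 i + (v s i - q0 i))).
  by apply: eq_Rintegral => s _; rewrite addrC subrK.
have mI : measurable (`[0, theta]%classic : set (measurableTypeR R)) by [].
have ivq : mu.-integrable `[0, theta] (EFin \o (fun s => (v s i : R) - q0 i)).
  apply: (eq_integrable mI _ _ _ (integrableB mI vi (ic (q0 i)))) => s _.
  by rewrite /= -EFinB.
apply: etrans (RintegralD mI (ic (q0 i)) ivq) _.
rewrite (Rintegral_itv_cst true false (q0 i) theta0) subr0 mulrC; congr (_ + _).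
apply: eq_Rintegral => s.
by rewrite inE/= in_itv/= => s0; rewrite bi// addrC addKr.
Qed.

Lemma second_order_unique tau (p0 q0 : l2 R) b e e' :
  second_order_curve tau p0 q0 b e -> second_order_curve tau p0 q0 b e' ->
  forall t, 0 <= t <= tau -> e t = e' t.
Proof.
move=> [v vP eP] [v' vP' eP']; apply: integral_curve_unique eP _.
by apply: integral_curve_ext eP' => s st; exact: integral_curve_unique vP' vP _ st.
Qed.

Lemma exists_second_order theta (p0 q0 : l2 R) b beta : 0 <= theta ->
  admissible theta beta b -> exists e, second_order_curve theta p0 q0 b e.
Proof.
move=> theta0 [mb bM].
have [v vP] := exists_integral_curve q0 mb bM.
have [||e eP] := @exists_integral_curve _ theta p0 v (l2norm q0 + `|beta| * theta).
- by move=> i; exact: integral_curve_measurable vP.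
- move=> t /andP[t0 tt]; rewrite -(subrK q0 (v t)) addrC.
  apply: le_trans (ler_l2normD _ _) _; apply: lerD => //.
  rewrite -(integral_curve_init theta0 vP).
  apply: (@le_trans _ _ (beta * (t - 0))).
    apply: (integral_curve_lipschitz vP) => // s /andP[s0 st].
    by apply: bM; rewrite ltW//= (le_trans st).
  rewrite subr0; apply: (@le_trans _ _ (`|beta| * t)).
    by apply: ler_wpM2r => //; exact: ler_norm.
  exact: ler_wpM2l.
by exists e, v.
Qed.

Lemma second_order_reach theta (p0 q0 : l2 R) b e beta : 0 <= theta -> 0 <= beta ->
  (forall s, 0 <= s <= theta -> l2norm (b s) <= beta) ->
  second_order_curve theta p0 q0 b e ->
  l2norm (e theta - evader_drift theta p0 q0) <= beta * (theta ^+ 2 / 2).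
Proof.
move=> theta0 beta0 bM [v vP eP].
have := drift_lipschitz beta0 vP eP (lexx 0) theta0 (lexx theta) (lexx theta).
rewrite (integral_curve_init theta0 vP) (integral_curve_init theta0 eP) subrr scale0r addr0.
rewrite subr0 expr0n/= mul0r mulr0 subr0; apply.
by move=> s /andP[s0 st]; apply: bM; rewrite ltW.
Qed.

Lemma second_order_cst theta (p0 q0 c : l2 R) b e : 0 <= theta ->
  (forall s, 0 <= s <= theta -> b s = c) ->
  second_order_curve theta p0 q0 b e ->
  e theta = evader_drift theta p0 q0 + (theta ^+ 2 / 2) *: c.
Proof.
move=> theta0 bc eP; apply: l2P => i; rewrite (second_order_terminal i theta0 eP).
rewrite coordD coordZ; congr (_ + _).
transitivity (\int[mu]_(s in `[0, theta]) ((c i : R) * (s - 0))).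
  apply: eq_Rintegral => s; rewrite inE/= in_itv/= => /andP[s0 st].
  rewrite -(Rintegral_itv_cst true false (c i) s0); apply: eq_Rintegral => r.
  by rewrite inE/= in_itv/= => /andP[r0 rs]; rewrite bc// r0 (le_trans rs).
have := Rintegral_itv_sub theta0; rewrite Rintegral_itv_obnd_cbnd; last first.
  by apply: integrableS (integrable_itv_sub 0 0 theta) => //; apply: subset_itvr; rewrite bnd_simp.
rewrite subr0 => <-; rewrite RintegralZl//; first exact: mulrC.
exact: integrable_itv_sub.
Qed.

End SecondOrder.

(** * Strategies and the value *)

Section Strategies.
Context {R : realType}.
Local Notation mu := (@lebesgue_measure R).
Implicit Types (f b v e : R -> l2 R) (t s tau theta alpha beta r : R).

(** For [0 <= r], the metric projection onto the ball of radius [r] around 0. *)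
Definition clip r (x : l2 R) : l2 R :=
  if l2norm x <= r then x else (r / l2norm x) *: x.

Lemma clip_norm r x : 0 <= r -> l2norm (clip r x) <= r.
Proof.
move=> r0; rewrite /clip; case: (leP (l2norm x) r) => [//|rx].
have x0 : 0 < l2norm x := le_lt_trans r0 rx.
by rewrite l2normZ ger0_norm ?divfK ?gt_eqF// divr_ge0// ltW.
Qed.

Lemma clip_dist r x : 0 <= r -> l2norm (x - clip r x) <= Num.max 0 (l2norm x - r).
Proof.
move=> r0; rewrite /clip; case: (leP (l2norm x) r) => [_|rx].
  by rewrite subrr l2norm0 le_max lexx.
have x0 : 0 < l2norm x := le_lt_trans r0 rx.
have -> : x - (r / l2norm x) *: x = (1 - r / l2norm x) *: x.
  by apply: l2P => i; rewrite !(coordD, coordN, coordZ); ring.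
rewrite l2normZ ger0_norm; last by rewrite subr_ge0 ler_pdivrMr// mul1r ltW.
by rewrite mulrBl mul1r divfK ?gt_eqF// le_max lexx orbT.
Qed.

Lemma integral_curve_cst tau (x0 : l2 R) f x (c : l2 R) t t' : integral_curve tau x0 f x ->
  0 <= t -> t <= t' -> t' <= tau -> (forall s, t < s <= t' -> f s = c) ->
  x t' = x t + (t' - t) *: c.
Proof.
move=> xP t0 tt' t'tau fc; apply: l2P => i.
have := integral_curve_incr i xP t0 tt' t'tau; rewrite coordD coordN.
have -> : \int[mu]_(s in `]t, t']) (f s i : R) = \int[mu]_(s in `]t, t']) (c i : R).
  by apply: eq_Rintegral => s; rewrite inE/= in_itv/= => st; rewrite fc.
by rewrite (Rintegral_itv_cst false false _ tt') !coordD coordZ; lra.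
Qed.

(* The final position of the evader, computed from what a pursuer strategy may depend on;
   [xget] only packs the coordinates into an element of [l2]. *)
Definition terminal theta (d : l2 R) b : l2 R :=
  xget 0 [set w : l2 R | forall i, w i = d i +
    \int[mu]_(s in `[0, theta]) \int[mu]_(r in `[0, s]) (b r i : R)].

Lemma terminal_ext theta d b b' : (forall t, 0 <= t <= theta -> b t = b' t) ->
  terminal theta d b = terminal theta d b'.
Proof.
move=> bb'; congr (xget 0 _).
suff E i : \int[mu]_(s in `[0, theta]) \int[mu]_(r in `[0, s]) (b r i : R) =
    \int[mu]_(s in `[0, theta]) \int[mu]_(r in `[0, s]) (b' r i : R).
  by apply/funext => w; apply/propext; split=> h i; rewrite (h i) ?E// -E.
apply: eq_Rintegral => s; rewrite inE/= in_itv/= => /andP[s0 st].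
apply: eq_Rintegral => r; rewrite inE/= in_itv/= => /andP[r0 rs].
by rewrite bb'// r0 (le_trans rs).
Qed.

Lemma terminalE theta (p0 q0 : l2 R) b e : 0 <= theta -> second_order_curve theta p0 q0 b e ->
  terminal theta (evader_drift theta p0 q0) b = e theta.
Proof.
move=> theta0 eP; apply: l2P => i.
have := second_order_terminal i theta0 eP => ->.
(* The default 0 is excluded, since [e theta] belongs to the set. *)
rewrite /terminal; case: xgetP => [w _ ->//|/(_ (e theta))[]].
by move=> j; exact: second_order_terminal.
Qed.

(** Constant velocity that leads, exactly at time [theta], to the point of the attainable ball
    nearest to the evader's final position. *)
Definition chase theta alpha : pursuer_strategy_type R :=
  fun p d b _ => theta^-1 *: clip (alpha * theta) (terminal theta d b - p).

Lemma chase_strategy theta alpha beta : 0 < theta -> 0 < alpha ->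
  pursuer_strategy theta alpha beta (chase theta alpha).
Proof.
move=> theta0 alpha0.
have speed p d b t : l2norm (chase theta alpha p d b t) <= alpha.
  rewrite l2normZ gtr0_norm ?invr_gt0// mulrC ler_pdivrMr//.
  by apply: clip_norm; rewrite mulr_ge0 ?ltW.
split=> [p d b bP|p d b b' _ _ bb' t _|p e0 e1 b bP].
- by split=> [i|t _]; [exact: measurable_cst|exact: speed].
- by rewrite /chase (terminal_ext d bb').
- have [x xP] : exists x,
      integral_curve theta p (chase theta alpha p (evader_drift theta e0 e1) b) x.
    by apply: exists_integral_curve => [i|t _]; [exact: measurable_cst|exact: speed].
  have [e eP] := exists_second_order e0 e1 (ltW theta0) bP.
  split; first by exists (fun t => (x t, e t)).
  move=> tau y z _ [y1 y2] [z1 z2] t tt.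
  rewrite (surjective_pairing (y t)) (surjective_pairing (z t)).
  by rewrite (integral_curve_unique y1 z1 tt) (second_order_unique y2 z2 tt).
Qed.

Lemma chase_dist theta alpha (p e0 e1 : l2 R) b x e : 0 < theta -> 0 < alpha ->
  integral_curve theta p (chase theta alpha p (evader_drift theta e0 e1) b) x ->
  second_order_curve theta e0 e1 b e ->
  l2norm (x theta - e theta) <= Num.max 0 (l2norm (e theta - p) - alpha * theta).
Proof.
move=> theta0 alpha0 xP eP; have theta0' := ltW theta0.
have xE := integral_curve_cst xP (lexx 0) theta0' (lexx theta) (fun _ _ => erefl).
rewrite {}xE (integral_curve_init theta0' xP) /chase (terminalE theta0' eP) subr0.
rewrite scalerA divff ?gt_eqF// scale1r l2distC opprD addrA.
by apply: clip_dist; rewrite mulr_ge0 ?ltW.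
Qed.

Lemma miss_distance_le (p : nat -> l2 R) (e : l2 R) (phi : R) :
  (forall eps, 0 < eps -> exists j, l2norm (p j - e) <= phi + eps) ->
  (miss_distance p e <= phi%:E)%E.
Proof.
move=> h; apply/lee_addgt0Pr => eps /h[j pj].
apply: le_trans (_ : _ <= (l2norm (p j - e))%:E)%E _; last by rewrite -EFinD lee_fin.
by apply: ereal_inf_lbound; exists j.
Qed.

Lemma miss_distance_ge (p : nat -> l2 R) (e : l2 R) (phi : R) :
  (forall j, phi <= l2norm (p j - e)) -> (phi%:E <= miss_distance p e)%E.
Proof. by move=> h; apply/ereal_infP => _ [j _ <-]; rewrite lee_fin. Qed.

Lemma pursuer_reach theta alpha (p : l2 R) f x : 0 <= theta -> admissible theta alpha f ->
  integral_curve theta p f x -> l2norm (x theta - p) <= alpha * theta.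
Proof.
move=> theta0 [_ fM] xP; rewrite -(integral_curve_init theta0 xP).
have := integral_curve_lipschitz xP (lexx 0) theta0 (lexx theta); rewrite subr0; apply.
by move=> s /andP[s0 st]; apply: fM; rewrite ltW.
Qed.

End Strategies.

(** * What direct chase and constant acceleration guarantee *)

Section Outcomes.
Context {R : realType}.
Variables (theta beta phi : R) (alpha : nat -> R) (p0 : nat -> l2 R) (epos evel : l2 R).
Hypotheses (theta0 : 0 < theta) (alpha0 : forall j, 0 < alpha j) (beta0 : 0 < beta).
Local Notation e0 := (evader_drift theta epos evel).
Local Notation G := (Game theta alpha beta p0 epos evel).
Local Notation rho := (beta * (theta ^+ 2 / 2)).

Lemma Psi1_chase_le :
  (forall eps, phi < eps ->
    l2ball e0 rho `<=` \bigcup_j l2ball (p0 j) (alpha j * theta + eps)) -> 0 <= phi ->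
  (Psi1 G (fun j => chase theta (alpha j)) <= phi%:E)%E.
Proof.
move=> cover phi0; apply/ereal_supP => _ [b [p [e [[_ bM] [/= pP eP] ->]]]].
apply: miss_distance_le => eps eps0.
have eb := second_order_reach (ltW theta0) (ltW beta0) bM eP.
have [|j _ ej] := cover (phi + eps) _ _ eb; first by rewrite ltrDl.
exists j; apply: le_trans (chase_dist theta0 (alpha0 j) (pP j) eP) _.
by rewrite ge_max addr_ge0 ?(ltW eps0)//= lerBlDl.
Qed.

Section FarPoint.
Variable x : l2 R.
Hypothesis xe : l2norm (x - e0) <= rho.
Hypothesis xfar : forall j (q : l2 R), l2norm (q - p0 j) <= alpha j * theta ->
  phi <= l2norm (q - x).

(** The constant acceleration that ends at [x]; the factor inverts the integral of [theta - t] over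
    the duration. *)
Let accel_to : l2 R := (theta ^+ 2 / 2)^-1 *: (x - e0).

Let theta2 : 0 < theta ^+ 2 / 2. Proof. by rewrite divr_gt0// exprn_gt0. Qed.

Let accel_to_norm : l2norm accel_to <= beta.
Proof.
by rewrite l2normZ gtr0_norm ?invr_gt0// mulrC ler_pdivrMr.
Qed.

Let accel_to_admissible : admissible theta beta (fun=> accel_to).
Proof. by split=> [i|t _]; [exact: measurable_cst|]. Qed.

Let accel_to_terminal b e : (forall s, 0 <= s <= theta -> b s = accel_to) ->
  second_order_curve theta epos evel b e -> e theta = x.
Proof.
move=> bE /(second_order_cst (ltW theta0) bE) ->.
by rewrite scalerA divff ?gt_eqF// scale1r addrC subrK.
Qed.

Lemma Psi1_ge A : pursuer_strategies G A -> (phi%:E <= Psi1 G A)%E.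
Proof.
move=> AP.
have /choice[p pP] j : exists p, integral_curve theta (p0 j)
    (A j (p0 j) e0 (fun=> accel_to)) p.
  have [_ _ /(_ (p0 j) epos evel _ accel_to_admissible)[[z [z1 _]] _]] := AP j.
  by exists (fun t => (z t).1).
have [e eP] := exists_second_order epos evel (ltW theta0) accel_to_admissible.
apply: le_trans (ereal_sup_ubound _); last by exists (fun=> accel_to), p, e.
apply: miss_distance_ge => j /=; rewrite (accel_to_terminal _ eP)//.
apply: xfar; have [adm _ _] := AP j.
exact: pursuer_reach (ltW theta0) (adm _ _ _ accel_to_admissible) (pP j).
Qed.

(** Constant feedback reduces the closed loop to an open one, whose solutions exist and are unique
    for all pursuer controls. *)
Lemma exists_evader_strategy : exists2 B, evader_strategy G B & (phi%:E <= Psi2 G B)%E.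
Proof.
exists (fun _ _ _ => accel_to).
  split=> [|t p e _|a aP]; [exact: measurable_cst|exact: accel_to_norm|].
  have /choice[p pP] j : exists p, integral_curve theta (p0 j) (a j) p.
    by have [ma aM] := aP j; exact: exists_integral_curve ma aM.
  have [e eP] := exists_second_order epos evel (ltW theta0) accel_to_admissible.
  split; first by exists (fun t => (p^~ t, e t)).
  move=> tau y z _ [y1 y2] [z1 z2] t tt.
  rewrite (surjective_pairing (y t)) (surjective_pairing (z t)).
  rewrite (second_order_unique y2 z2 tt); congr (_, _).
  by apply/funext => j; exact: integral_curve_unique (y1 j) (z1 j) _ tt.
apply/ereal_infP => _ [a [z [aP [zP eP] ->]]].
apply: miss_distance_ge => j /=; rewrite (accel_to_terminal _ eP)//.
by apply: xfar; exact: pursuer_reach (ltW theta0) (aP j) (zP j).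
Qed.

End FarPoint.
End Outcomes.

(** * Step-by-step pursuit of a closed-loop evader *)

Section Guarding.
Context {R : realType}.
Implicit Types (x : R -> l2 R) (t s tau : R).
Variables (theta beta : R) (alpha reach : nat -> R) (p0 : nat -> l2 R) (epos evel : l2 R).
Hypotheses (theta0 : 0 < theta) (alpha0 : forall j, 0 < alpha j) (beta0 : 0 < beta).
Hypothesis reach_gt0 : forall j, 0 < reach j.
Variable B : evader_strategy_type R.
Local Notation e0 := (evader_drift theta epos evel).
Local Notation G := (Game theta alpha beta p0 epos evel).
Local Notation rho := (beta * (theta ^+ 2 / 2)).
Hypothesis BP : evader_strategy G B.

(** The fictitious pursuer moves at speed at most [reach j / theta]; scaling by this ratio brings
    that bound to [alpha j]. *)
Definition speed_ratio j : R := alpha j * theta / reach j.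

(* [s] is the remaining fraction of time; the evader's reach shrinks like [s ^+ 2], that of
   the fictitious pursuers [P j] like [s]. The point [Y] follows the evader with a delay. *)
Definition guarded (delay s : R) : Prop :=
  exists (a : nat -> R -> l2 R) (p : nat -> R -> l2 R) (e v : R -> l2 R)
    (Y : l2 R) (P : nat -> l2 R),
  let t := theta * (1 - s) in
  [/\ forall j, admissible theta (alpha j) (a j),
      [/\ forall j, integral_curve theta (p0 j) (a j) (p j),
        integral_curve theta evel (fun t => B t (p^~ t) (e t)) v &
        integral_curve theta epos v e],
      l2norm (Y - e0) <= rho - s ^+ 2 * rho,
      l2norm (e t + (theta - t) *: v t - Y) <= delay &
      forall j, [/\ p j t = p0 j + speed_ratio j *: (P j - p0 j),
        l2norm (P j - p0 j) <= reach j * (1 - s) &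
        forall m : l2 R, bisector (@l2dot R) e0 rho (p0 j) (reach j) m ->
          l2norm (m - Y) <= s ^+ 2 * rho ->
          l2norm (m - P j) ^+ 2 - (s * reach j) ^+ 2 <=
          l2norm (m - Y) ^+ 2 - (s ^+ 2 * rho) ^+ 2]].

Lemma closed_loop_exists (a : nat -> R -> l2 R) :
  (forall j, admissible theta (alpha j) (a j)) ->
  exists (p : nat -> R -> l2 R) (e v : R -> l2 R),
   [/\ forall j, integral_curve theta (p0 j) (a j) (p j),
        integral_curve theta evel (fun t => B t (p^~ t) (e t)) v &
        integral_curve theta epos v e].
Proof.
move=> aP; have [_ _ /(_ a aP)[[z [zp [v vP eP]]] _]] := BP.
by exists (fun j t => (z t).1 j), (fun t => (z t).2), v.
Qed.

(** Causality: controls may be changed after [tau] without altering the trajectory up to [tau]. It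
    rests on uniqueness on the initial segment [[0, tau]]. *)
Lemma closed_loop_unique (a a' : nat -> R -> l2 R) p p' (e v e' v' : R -> l2 R) tau :
  (forall j, admissible theta (alpha j) (a' j)) -> 0 <= tau <= theta ->
  (forall j t, 0 <= t <= tau -> a j t = a' j t) ->
  (forall j, integral_curve theta (p0 j) (a j) (p j)) ->
  integral_curve theta evel (fun t => B t (p^~ t) (e t)) v ->
  integral_curve theta epos v e ->
  (forall j, integral_curve theta (p0 j) (a' j) (p' j)) ->
  integral_curve theta evel (fun t => B t (p'^~ t) (e' t)) v' ->
  integral_curve theta epos v' e' ->
  forall t, 0 <= t <= tau -> [/\ forall j, p j t = p' j t, e t = e' t & v t = v' t].
Proof.
move=> a'P tt aa' pP vP eP pP' vP' eP'.
have /andP[_ tt'] := tt.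
have [_ _ /(_ a' a'P)[_ uniq]] := BP.
have zz t : 0 <= t <= tau -> (p^~ t, e t) = (p'^~ t, e' t).
  apply: (uniq tau (fun t => (p^~ t, e t)) (fun t => (p'^~ t, e' t)) tt).
    split=> [j|]; last by exists v; exact: integral_curve_restrict tt' _.
    by apply: integral_curve_ext (integral_curve_restrict tt' (pP j)) => s; exact: aa'.
  split=> [j|]; last by exists v'; exact: integral_curve_restrict tt' _.
  exact: integral_curve_restrict tt' (pP' j).
move=> t t_tau; have [pE eE] := zz t t_tau; split=> //.
  by move=> j; exact: (congr1 (fun q => q j) pE).
apply: (integral_curve_unique (integral_curve_restrict tt' vP) _ t_tau).
apply: integral_curve_ext (integral_curve_restrict tt' vP') => s /zz[-> ->].
by [].
Qed.

(** At the start [Y] is the drift point and [P j] is [p0 j], so that guarding is the very inequality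
    defining the half-space. *)
Lemma guarded1 delay : 0 <= delay -> guarded delay 1.
Proof.
move=> delay0.
have aP j : admissible theta (alpha j) (fun=> 0 : l2 R).
  by split=> [i|t _]; [exact: measurable_cst|rewrite l2norm0 ltW].
have [p [e [v [pP vP eP]]]] := closed_loop_exists aP.
exists (fun _ _ => 0), p, e, v, e0, p0 => t; rewrite {}/t.
rewrite (subrr (1 : R)) mulr0 subr0 expr1n !mul1r !subrr l2norm0.
rewrite (integral_curve_init (ltW theta0) eP) (integral_curve_init (ltW theta0) vP).
rewrite -[epos + _]/e0 subrr l2norm0; split=> // j.
rewrite subrr l2norm0 mulr0 scaler0 addr0 (integral_curve_init (ltW theta0) (pP j)).
by split=> // m mb _; rewrite mul1r.
Qed.

Lemma admissible_switch rate (a : R -> l2 R) (c : l2 R) tau :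
  admissible theta rate a -> l2norm c <= rate ->
  admissible theta rate (fun t => if t <= tau then a t else c).
Proof.
move=> [ma aM] cM; split=> [i|t tt]; last by case: ifP => // _; exact: aM.
have -> : (fun t => ((if t <= tau then a t else c) i : R)) =
    (fun t => if t <= tau then (a t i : R) else c i).
  by apply/funext => t; case: ifP.
apply: measurable_fun_if => //.
- exact: measurable_fun_ler.
- by apply: measurable_funS (ma i) => //; exact: subIsetl.
Qed.

(** During the step the evader's reach decreases by [d], which is at most [2 * rho * u]. The point
    [Y] moves by at most [d] towards the predicted position [y] known at the beginning, while [y]
    itself moves by at most [d]. The new delay is thus at most the larger of [d] and the old
    delay. *)
Lemma guarded_step_time s u : 0 < u -> u <= s -> s <= 1 ->
  guarded (2 * rho * u) s -> guarded (2 * rho * u) (s - u).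
Proof.
move=> u0 us s1.
have s0 : 0 < s := lt_le_trans u0 us.
have rho0 : 0 < rho by rewrite mulr_gt0 ?divr_gt0 ?exprn_gt0.
pose d := s ^+ 2 * rho - (s - u) ^+ 2 * rho.
have d0 : 0 <= d.
  rewrite subr_ge0 ler_pM2r// ler_pXn2r ?nnegrE ?subr_ge0 ?(ltW s0)//; lra.
have d_le : d <= 2 * rho * u.
  (* The factor [2 * s - u] is at most 2, which makes the same delay serve for all steps. *)
  have -> : d = (2 * s - u) * rho * u by rewrite /d; ring.
  by rewrite ler_pM2r// ler_pM2r//; lra.
(* [guard_step] measures the fraction kept of the current reaches [s ^+ 2 * rho] and [s * reach j],
   not of the initial ones. *)
pose q := (s - u) / s.
have q01 : 0 <= q < 1.
  by rewrite divr_ge0 ?subr_ge0 ?(ltW s0)//= ltr_pdivrMr// mul1r; lra.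
have qs : q * s = s - u by rewrite divfK// gt_eqF.
have q2s : q ^+ 2 * (s ^+ 2 * rho) = (s - u) ^+ 2 * rho by rewrite mulrA -exprMn qs.
have tu0 : 0 < theta * u by rewrite mulr_gt0.
have ratio0 j : 0 < speed_ratio j by rewrite divr_gt0// mulr_gt0.
pose t := theta * (1 - s); pose t' := theta * (1 - (s - u)).
have t0 : 0 <= t by rewrite mulr_ge0 ?subr_ge0 ?(ltW theta0).
have ttheta : t <= theta.
  by rewrite -subr_ge0 (_ : theta - t = theta * s) ?mulr_ge0 ?(ltW theta0) ?(ltW s0)// /t; ring.
have tt : 0 <= t <= theta by rewrite t0.
have t'E : t' = t + theta * u by rewrite /t' /t; ring.
have tt' : t <= t' by rewrite t'E lerDl ltW.
have t'theta : t' <= theta.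
  by rewrite -subr_ge0 (_ : theta - t' = theta * (s - u))
    ?mulr_ge0 ?subr_ge0 ?(ltW theta0)// /t'; ring.
have dE : beta * ((theta - t) ^+ 2 / 2) - beta * ((theta - t') ^+ 2 / 2) = d.
  by rewrite /d /t /t'; field.
have ratio_alpha j : speed_ratio j / (theta * u) * (u * reach j) = alpha j.
  by rewrite /speed_ratio; field; rewrite !gt_eqF//=.
have tdiff : t' - t = theta * u by rewrite t'E; ring.
have dsum : d + (rho - s ^+ 2 * rho) = rho - (s - u) ^+ 2 * rho by rewrite /d; ring.
have uq j : (1 - q) * (s * reach j) = u * reach j.
  by rewrite mulrA mulrBl mul1r qs opprB addrCA subrr addr0.
have srho0 : 0 <= s ^+ 2 * rho by rewrite ltW// mulr_gt0 ?exprn_gt0.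
have sreach0 j : 0 <= s * reach j by rewrite ltW// mulr_gt0.
have reach_sum j : u * reach j + reach j * (1 - s) = reach j * (1 - (s - u)) by ring.
move=> [a [p [e [v [Y [P [aP [pP vP eP] Ye yY inv]]]]]]].
rewrite -/t in yY inv; set y := e t + (theta - t) *: v t in yY.
pose Y' := Y + clip d (y - Y).
have YY' : l2norm (Y' - Y) <= d.
  by rewrite /Y' addrAC subrr add0r; exact: clip_norm.
have /choice[P' P'P] j : exists P' : l2 R, l2norm (P' - P j) <= u * reach j /\
    forall m : l2 R, bisector (@l2dot R) e0 rho (p0 j) (reach j) m ->
      l2norm (m - Y') <= (s - u) ^+ 2 * rho ->
      l2norm (m - P') ^+ 2 - ((s - u) * reach j) ^+ 2 <=
      l2norm (m - Y') ^+ 2 - ((s - u) ^+ 2 * rho) ^+ 2.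
  have [_ _ invj] := inv j.
  have := @guard_step R (l2 R) (@l2dot R) l2_hilbert
    (bisector (@l2dot R) e0 rho (p0 j) (reach j)) Y Y' (P j) (s ^+ 2 * rho) (s * reach j) q
    (@convex_bisector R (l2 R) (@l2dot R) l2_hilbert e0 rho (p0 j) (reach j))
    (@dclosed_bisector R (l2 R) (@l2dot R) l2_hilbert e0 rho (p0 j) (reach j)) q01.
  rewrite q2s (mulrA q s (reach j)) qs uq; apply;
    [exact: srho0|exact: sreach0|exact: YY'|exact: invj].
(* The velocity that carries the actual pursuer, in time [theta * u], to the scaled image of
   [P' j]. *)
pose c j : l2 R := (speed_ratio j / (theta * u)) *: (P' j - P j).
have cM j : l2norm (c j) <= alpha j.
  rewrite l2normZ gtr0_norm; last exact: divr_gt0.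
  have [h _] := P'P j; rewrite -[leRHS]ratio_alpha; apply: ler_wpM2l h.
  by apply: ltW; exact: divr_gt0.
pose a' j r := if r <= t then a j r else c j.
have a'P j : admissible theta (alpha j) (a' j) by exact: admissible_switch.
have [p' [e' [v' [pP' vP' eP']]]] := closed_loop_exists a'P.
(* The data [Y'], [P'] and [c] were computed along the old trajectory; by causality the new one has
   the same state at time [t]. *)
have [pE eE vE] : [/\ forall j, p j t = p' j t, e t = e' t & v t = v' t].
  apply: (closed_loop_unique a'P tt _ pP vP eP pP' vP' eP'); last by rewrite t0 lexx.
  by move=> j r /andP[_ rt]; rewrite /a' rt.
exists a', p', e', v', Y', P' => /=; rewrite -/t'; split=> //.
- apply: le_trans (ler_l2distD Y _ _) _; apply: le_trans (lerD YY' Ye) _.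
  by rewrite dsum.
- have [_ BM _] := BP.
  have yy' : l2norm (e' t' + (theta - t') *: v' t' - y) <= d.
    rewrite /y eE vE.
    apply: le_trans (drift_lipschitz (ltW beta0) vP' eP' t0 tt' t'theta (lexx theta) _) _.
      by move=> r /andP[tr rt']; apply: BM; rewrite /= (le_trans t0 (ltW tr)) (le_trans rt').
    by rewrite dE.
  have yclip : l2norm (y - Y') <= Num.max 0 (l2norm (y - Y) - d).
    by rewrite /Y' opprD addrA; exact: clip_dist.
  apply: le_trans (ler_l2distD y _ _) _; apply: le_trans (lerD yy' yclip) _.
  rewrite addr_maxr ge_max addr0 d_le /=; apply: le_trans _ yY.
  by rewrite addrC subrK.
- move=> j; have [pj Pj _] := inv j; have [P'j1 P'j2] := P'P j; split=> //.
  + have -> : p' j t' = p' j t + (t' - t) *: c j.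
      apply: (integral_curve_cst (pP' j) t0 tt' t'theta) => r /andP[tr _].
      by rewrite /a' leNgt tr.
    rewrite -pE pj tdiff /c scalerA.
    have -> : theta * u * (speed_ratio j / (theta * u)) = speed_ratio j.
      by rewrite mulrC divfK// gt_eqF.
    by apply: l2P => i; rewrite !(coordD, coordN, coordZ); ring.
  + apply: le_trans (ler_l2distD (P j) _ _) _; apply: le_trans (lerD P'j1 Pj) _.
    by rewrite reach_sum.
Qed.

(** Equal steps of length [1/(n+1)] lead from [s = 1] to [s = 0]; the final delay tends to 0 as [n]
    grows. *)
Lemma guarded0 n : guarded (2 * rho / n.+1%:R) 0.
Proof.
have u0 : 0 < n.+1%:R^-1 :> R by rewrite invr_gt0.
have rho0 : 0 <= rho by rewrite mulr_ge0 ?divr_ge0 ?exprn_ge0 ?ltW.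
suff h k : (k <= n.+1)%N -> guarded (2 * rho * n.+1%:R^-1) (1 - k%:R * n.+1%:R^-1).
  by have := h _ (leqnn _); rewrite divff ?subrr// pnatr_eq0.
elim: k => [_|k IH kn]; first by rewrite mul0r subr0; apply: guarded1;
  rewrite mulr_ge0 ?mulr_ge0 ?ltW.
have -> : 1 - k.+1%:R * n.+1%:R^-1 = 1 - k%:R * n.+1%:R^-1 - n.+1%:R^-1 :> R.
  by rewrite -natr1; ring.
have kn' : k%:R * n.+1%:R^-1 + n.+1%:R^-1 <= 1 :> R.
  by rewrite -[X in _ + X]mul1r -mulrDl natr1 ler_pdivrMr// mul1r ler_nat.
have k0 : 0 <= k%:R * n.+1%:R^-1 :> R by rewrite mulr_ge0 ?ler0n ?(ltW u0).
apply: guarded_step_time; [exact: u0|by rewrite lerBrDl|by rewrite gerBl|exact: IH (ltnW kn)].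
Qed.

End Guarding.

(** * The closed-loop upper bound and the value *)

Section Value.
Context {R : realType}.
Variables (theta beta phi : R) (alpha : nat -> R) (p0 : nat -> l2 R) (epos evel gamma : l2 R).
Hypotheses (theta0 : 0 < theta) (alpha0 : forall j, 0 < alpha j) (beta0 : 0 < beta).
Local Notation e0 := (evader_drift theta epos evel).
Local Notation G := (Game theta alpha beta p0 epos evel).
Local Notation rho := (beta * (theta ^+ 2 / 2)).
Hypotheses (gamma0 : gamma <> 0) (gamma_ge0 : forall j, 0 <= l2dot (e0 - p0 j) gamma).
Hypothesis phi0 : 0 <= phi.
Hypothesis cover : forall eps, phi < eps ->
  l2ball e0 rho `<=` \bigcup_j l2ball (p0 j) (alpha j * theta + eps).

Lemma Psi2_le B : evader_strategy G B -> (Psi2 G B <= phi%:E)%E.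
Proof.
move=> BP; apply/lee_addgt0Pr => eps eps0.
have rho0 : 0 < rho by rewrite mulr_gt0 ?divr_gt0 ?exprn_gt0.
have eps2 : 0 < eps / 2 by rewrite divr_gt0.
(* One half of [eps] makes the enlarged balls cover, the other absorbs the final delay of [Y]. *)
pose reach j := alpha j * theta + (phi + eps / 2).
have at0 j : 0 < alpha j * theta by rewrite mulr_gt0.
have reach0 j : 0 < reach j by rewrite addr_gt0// ltr_wpDl.
have [n nP] : exists n, 2 * rho / n.+1%:R <= eps / 2.
  exists (Num.trunc ((eps / 2)^-1 * (2 * rho))).
  by rewrite ler_pdivrMr// -ler_pdivrMl// ltW// truncnS_gt.
have coverY : hball (@l2dot R) e0 rho `<=` \bigcup_j hball (@l2dot R) (p0 j) (reach j).
  by apply: cover; rewrite ltrDl.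
have ratio_reach j : (1 - speed_ratio theta alpha reach j) * reach j = phi + eps / 2.
  by rewrite /speed_ratio mulrBl mul1r divfK ?gt_eqF// /reach addrAC subrr add0r.
have ratio1 j : 0 <= 1 - speed_ratio theta alpha reach j.
  by rewrite -(pmulr_lge0 _ (reach0 j)) ratio_reach addr_ge0// ltW.
have [a [p [e [v [Y [P]]]]]] :=
  @guarded0 R theta beta alpha reach p0 epos evel theta0 alpha0 beta0 reach0 B BP n.
rewrite subr0 mulr1 expr0n/= !mul0r subr0 subrr scale0r addr0.
move=> [aP [pP vP eP] Ye eY inv].
(* At [s = 0] the point [Y] is only known to lie in the evader's ball; this selects the pursuer
   whose half-space contains it. Guarding with both reaches zero then forces [P j = Y]. *)
have [j Yj] := covered_bisector l2_hilbert gamma0 gamma_ge0 (fun j => ltW (reach0 j)) coverY Ye.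
have [pj Pj /(_ Y Yj)] := inv j.
rewrite subrr l2norm0 => /(_ (lexx 0)); rewrite !mul0r expr0n/= !subr0 => YP.
have {}YP : P j = Y.
  apply/esym/eqP; rewrite -subr_eq0; apply/eqP/(hnorm0_eq0 l2_hilbert).
  by rewrite -(@ler_pXn2r _ 2) ?nnegrE ?l2norm_ge0// expr0n.
apply: (@le_trans _ _ (l2norm (p j theta - e theta))%:E).
  apply: le_trans (_ : _ <= miss_distance (p^~ theta) (e theta))%E _.
    apply: ereal_inf_lbound; exists a, (fun t => (p^~ t, e t)); split=> //.
    by split=> //; exists v.
  by apply: ereal_inf_lbound; exists j.
rewrite -EFinD lee_fin; apply: le_trans (ler_l2distD Y _ _) _.
rewrite (l2distC Y) (splitr eps) addrA.
apply: lerD; last exact: le_trans eY nP.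
(* The actual pursuer trails its fictitious one by the fraction [1 - speed_ratio] of a displacement
   of length at most [reach j], that is by at most [phi + eps / 2]. *)
have -> : p j theta - Y = (speed_ratio theta alpha reach j - 1) *: (P j - p0 j).
  by rewrite pj YP; apply: l2P => i; rewrite !(coordD, coordN, coordZ); ring.
rewrite l2normZ distrC ger0_norm// -(ratio_reach j); apply: ler_wpM2l => //.
by apply: le_trans Pj _; rewrite mulr1.
Qed.

(** The bounds hold against every strategy of the same side: no pursuer strategies go below [phi]
    and no evader strategy above it, so attaining [phi] is optimal. *)
Lemma value_of_covering :
  (forall eps, 0 <= eps < phi ->
    ~ (l2ball e0 rho `<=` \bigcup_j l2ball (p0 j) (alpha j * theta + eps))) ->
  is_value G phi.
Proof.
move=> uncovered.
have rho0 : 0 <= rho by rewrite mulr_ge0 ?divr_ge0 ?exprn_ge0 ?ltW.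
have [x xe xfar] := exists_far_point l2_hilbert gamma0 gamma_ge0
  (fun j => ltW (mulr_gt0 (alpha0 j) theta0)) rho0 phi0 uncovered.
have [B BP B_ge] := exists_evader_strategy theta0 xe xfar.
have A_ge := Psi1_ge theta0 xe xfar.
pose A j := chase theta (alpha j).
have AP : pursuer_strategies G A by move=> j; exact: chase_strategy.
have PsiA : Psi1 G A = phi%:E.
  apply/le_anti/andP; split; last exact: A_ge.
  exact: Psi1_chase_le theta0 alpha0 beta0 cover phi0.
have PsiB : Psi2 G B = phi%:E by apply/le_anti; rewrite B_ge Psi2_le.
exists A, B; split=> //; split=> //.
- apply/le_anti/andP; split; last by apply: ereal_inf_lbound; exists A.
  by apply/ereal_infP => _ [A' A'P <-]; rewrite PsiA; exact: A_ge.
- apply/le_anti/andP; split; first by apply: ereal_sup_ubound; exists B.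
  by apply/ereal_supP => _ [B' B'P <-]; rewrite PsiB; exact: Psi2_le.
Qed.

End Value.

Theorem theorem4p1 (R : realType) (theta : R) (alpha : nat -> R) (beta : R)
    (p0 : nat -> l2 R) (epos evel gamma : l2 R) :
  let e0 := evader_drift theta epos evel in
  0 < theta -> (forall j, 0 < alpha j) -> 0 < beta ->
  gamma <> 0 -> (forall j, 0 <= l2dot (e0 - p0 j) gamma) ->
  is_value (Game theta alpha beta p0 epos evel)
    (inf [set eps : R | 0 <= eps /\
       l2ball e0 (beta * (theta ^+ 2 / 2)) `<=`
         \bigcup_j l2ball (p0 j) (alpha j * theta + eps)]).
Proof.
move=> e0 theta0 alpha0 beta0 gamma0 gamma_ge0.
set S := [set eps | _].
have S_lb : lbound S 0 by move=> eps [].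
(* A single large ball around [p0 0] covers, so that [inf S] is a genuine infimum and not a default
   value. *)
have S_ne : S !=set0.
  pose r := beta * (theta ^+ 2 / 2).
  have r0 : 0 <= r by rewrite mulr_ge0 ?divr_ge0 ?exprn_ge0 ?ltW.
  exists (r + l2norm (e0 - p0 0%N)); split; first by rewrite addr_ge0 ?l2norm_ge0.
  move=> x xr; exists 0%N => //; apply: le_trans (ler_l2distD e0 _ _) _.
  apply: le_trans (lerD xr (lexx _)) _.
  by rewrite lerDr ltW// mulr_gt0.
have S_inf : has_inf S by split; [|exists 0].
(* Upward closure turns the infimum into a threshold: covering holds at every level above it. *)
have S_up eps eps' : S eps -> eps <= eps' -> S eps'.
  move=> [eps0 h] le; split; first exact: le_trans le.
  by move=> x /h[j _ xj]; exists j => //; apply: le_trans xj _; rewrite lerD2l.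
apply: (value_of_covering theta0 alpha0 beta0 gamma0 gamma_ge0).
- exact: lb_le_inf.
- move=> eps lt_eps.
  have d0 : 0 < eps - inf S by rewrite subr_gt0.
  have [eps' S' lt'] := inf_adherent d0 S_inf.
  by apply: (S_up eps' _ S' _).2; rewrite addrC subrK in lt'; exact: ltW.
- move=> eps /andP[eps0 lt_eps] h.
  by move: lt_eps; rewrite ltNge => /negP; apply; apply: ge_inf; [exists 0|].
Qed.
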